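(* The group $(E_6)^{\gamma_3}\cap(E_6)^{w_3}$ is isomorphic to $(U(1)\times U(1)\times SU(3)\times SU(3))/(\mathbb{Z}_2\times\mathbb{Z}_3)$, where $\mathbb{Z}_2=\{(1,1,E,E),(-1,-1,E,E)\}$ and $\mathbb{Z}_3=\{(1,1,E,E),(1,\omega,\omega^{-1}E,\omega E),(1,\omega^{-1},\omega E,\omega^{-1}E)\}$.
   Context: Let $\mathbf{H}$ be the quaternions with units $e_1,e_2,e_3=e_1e_2$, and $\mathbf{C}=\{x+ye_1: x,y\in\mathbb{R}\}\subset\mathbf{H}$. Let $\mathfrak{C}=\mathbf{H}\oplus\mathbf{H}e_4$ be the division Cayley algebra with multiplication $(m+ne_4)(p+qe_4)=(mp-\bar q n)+(n\bar p+qm)e_4$ and conjugation $\overline{m+ne_4}=\bar m-ne_4$. Let $\mathfrak{J}=\{X\in M(3,\mathfrak{C}):X^*=X\}$, with elements $X=\begin{pmatrix}\xi_1&x_3&\overline{x_2}\\ \overline{x_3}&\xi_2&x_1\\ x_2&\overline{x_1}&\xi_3\end{pmatrix}$, $\xi_i\in\mathbb{R}$, $x_i\in\mathfrak{C}$, and with $X\circ Y=\tfrac12(XY+YX)$, $(X,Y)=\mathrm{tr}(X\circ Y)$, $X\times Y=\tfrac12(2X\circ Y-\mathrm{tr}(X)Y-\mathrm{tr}(Y)X+(\mathrm{tr}(X)\mathrm{tr}(Y)-(X,Y))E)$, $\det X=\tfrac13(X,X\times X)$. Let $C=\{x+iy:x,y\in\mathbb{R}\}$, where $i$ commutes with all of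 $\mathfrak{C}$; let $\mathfrak{J}^C=\mathfrak{J}\oplus i\mathfrak{J}$ be the complexification with these operations extended $C$-linearly. Let $\tau$ denote complex conjugation with respect to $i$ and $\langle X,Y\rangle=(\tau X,Y)$. Put $E_6=\{\alpha\in\mathrm{Iso}_C(\mathfrak{J}^C):\det\alpha X=\det X,\ \langle\alpha X,\alpha Y\rangle=\langle X,Y\rangle\}$, where $\mathrm{Iso}_C$ denotes $C$-linear isomorphisms. Let $\boldsymbol{\omega}=-\tfrac12+\tfrac{\sqrt3}{2}e_1\in\mathbf{C}$ and $\omega=-\tfrac12+\tfrac{\sqrt3}{2}i\in C$. On $\mathfrak{C}$ let $\gamma_3(m+ne_4)=m+(\boldsymbol{\omega}n)e_4$; and, writing $\mathfrak{C}=\mathbf{C}\oplus\mathbf{C}^3$ with $\mathbf{C}^3=\mathbf{C}e_2\oplus\mathbf{C}e_4\oplus\mathbf{C}e_6$ (where $e_6=\pm e_2e_4$; the sign is irrelevant) the orthogonal complement of $\mathbf{C}$, let $w_3(m_0+\mathbf{m})=m_0+\boldsymbol{\omega}\mathbf{m}$. These are extended to $\mathfrak{J}$ by fixing each $\xi_i$ and acting on each $x_i$, and then $C$-linearly to elements $\gamma_3,w_3\in E_6$. For $g\in E_6$, $(E_6)^g=\{\alpha\in E_6:g^{-1}\alpha g=\alpha\}$. $U(1)$ is the group of unit complex numbers, $E$ the unit matrix. *)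

(* Defs.v *)
From HB Require Import structures.
From mathcomp Require Import all_boot all_order all_algebra.
From mathcomp Require Import generic_quotient spectral complex ring.
From mathcomp Require Import boolp classical_sets functions reals.
From mathcomp Require Import topology normedtype.

Set Implicit Arguments.
Unset Strict Implicit.
Unset Printing Implicit Defensive.

Import Order.TTheory GRing.Theory Num.Theory.
Import numFieldNormedType.Exports.
Local Open Scope ring_scope.

(* The algebras are defined over an arbitrary number field K.  All structure
   constants are rational, so K = R gives H, the division Cayley algebra and
   the Jordan algebra J, while K = R[i] gives their complexifications, with
   every operation (in particular the conjugation of Cayley numbers) extended
   C-linearly. *)

(* Quat a0 a1 a2 a3 is a0 + a1 e1 + a2 e2 + a3 e3. *)
Record quat (K : Type) := Quat { qc0 : K; qc1 : K; qc2 : K; qc3 : K }.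

Section QuatModule.
Variable K : numFieldType.
Implicit Types p q r : quat K.

Definition quat_tuple p : K * K * K * K := (qc0 p, qc1 p, qc2 p, qc3 p).
Definition tuple_quat (t : K * K * K * K) : quat K :=
  let: (a0, a1, a2, a3) := t in Quat a0 a1 a2 a3.
Fact quat_tupleK : cancel quat_tuple tuple_quat. Proof. by case. Qed.
HB.instance Definition _ := Choice.copy (quat K) (can_type quat_tupleK).

Definition qadd p q :=
  Quat (qc0 p + qc0 q) (qc1 p + qc1 q) (qc2 p + qc2 q) (qc3 p + qc3 q).
Definition qopp p := Quat (- qc0 p) (- qc1 p) (- qc2 p) (- qc3 p).
Definition qscale (a : K) p :=
  Quat (a * qc0 p) (a * qc1 p) (a * qc2 p) (a * qc3 p).

Fact qaddA : associative qadd.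
Proof. by move=> p q r; rewrite /qadd /= !addrA. Qed.
Fact qaddC : commutative qadd.
Proof. by move=> p q; congr Quat; apply: addrC. Qed.
Fact qadd0 : left_id (Quat 0 0 0 0) qadd.
Proof. by case=> *; rewrite /qadd /= !add0r. Qed.
Fact qaddN : left_inverse (Quat 0 0 0 0) qopp qadd.
Proof. by case=> *; rewrite /qadd /= !addNr. Qed.
HB.instance Definition _ :=
  GRing.isZmodule.Build (quat K) qaddA qaddC qadd0 qaddN.

Fact qscaleA a b p : qscale a (qscale b p) = qscale (a * b) p.
Proof. by congr Quat; apply: mulrA. Qed.
Fact qscale1 : left_id 1 qscale.
Proof. by case=> *; rewrite /qscale /= !mul1r. Qed.
Fact qscaleDr : right_distributive qscale +%R.
Proof. by move=> a p q; congr Quat; apply: mulrDr. Qed.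
Fact qscaleDl p : {morph qscale^~ p : a b / a + b}.
Proof. by move=> a b; congr Quat; apply: mulrDl. Qed.
HB.instance Definition _ := GRing.Zmodule_isLmodule.Build K (quat K)
  qscaleA qscale1 qscaleDr qscaleDl.

End QuatModule.

(* (m, n) is m + n e4. *)
Notation oct K := (quat K * quat K)%type.

(* The coordinates of a Hermitian 3 x 3 matrix over the Cayley numbers; the
   matrix itself is [hmx] below. *)
Record jordan (K : Type) := Jordan {
  jxi1 : K; jxi2 : K; jxi3 : K; jx1 : oct K; jx2 : oct K; jx3 : oct K }.

Section JordanModule.
Variable K : numFieldType.
Implicit Types X Y Z : jordan K.

Definition jordan_tuple X : K * K * K * oct K * oct K * oct K :=
  (jxi1 X, jxi2 X, jxi3 X, jx1 X, jx2 X, jx3 X).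
Definition tuple_jordan (t : K * K * K * oct K * oct K * oct K) : jordan K :=
  let: (a1, a2, a3, x1, x2, x3) := t in Jordan a1 a2 a3 x1 x2 x3.
Fact jordan_tupleK : cancel jordan_tuple tuple_jordan. Proof. by case. Qed.
HB.instance Definition _ := Choice.copy (jordan K) (can_type jordan_tupleK).

Definition jadd X Y :=
  Jordan (jxi1 X + jxi1 Y) (jxi2 X + jxi2 Y) (jxi3 X + jxi3 Y)
         (jx1 X + jx1 Y) (jx2 X + jx2 Y) (jx3 X + jx3 Y).
Definition jopp X :=
  Jordan (- jxi1 X) (- jxi2 X) (- jxi3 X) (- jx1 X) (- jx2 X) (- jx3 X).
Definition jscale (a : K) X :=
  Jordan (a * jxi1 X) (a * jxi2 X) (a * jxi3 X)
         (a *: jx1 X) (a *: jx2 X) (a *: jx3 X).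

Fact jaddA : associative jadd.
Proof. by move=> X Y Z; congr Jordan; apply: addrA. Qed.
Fact jaddC : commutative jadd.
Proof. by move=> X Y; congr Jordan; apply: addrC. Qed.
Fact jadd0 : left_id (Jordan 0 0 0 0 0 0) jadd.
Proof. by case=> *; congr Jordan; apply: add0r. Qed.
Fact jaddN : left_inverse (Jordan 0 0 0 0 0 0) jopp jadd.
Proof. by case=> *; congr Jordan; apply: addNr. Qed.
HB.instance Definition _ :=
  GRing.isZmodule.Build (jordan K) jaddA jaddC jadd0 jaddN.

Fact jscaleA a b X : jscale a (jscale b X) = jscale (a * b) X.
Proof. by congr Jordan; rewrite /= ?mulrA ?scalerA. Qed.
Fact jscale1 : left_id 1 jscale.
Proof. by case=> *; congr Jordan; rewrite /= ?mul1r ?scale1r. Qed.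
Fact jscaleDr : right_distributive jscale +%R.
Proof. by move=> a X Y; congr Jordan; rewrite /= ?mulrDr ?scalerDr. Qed.
Fact jscaleDl X : {morph jscale^~ X : a b / a + b}.
Proof. by move=> a b; congr Jordan; rewrite /= ?mulrDl ?scalerDl. Qed.
HB.instance Definition _ := GRing.Zmodule_isLmodule.Build K (jordan K)
  jscaleA jscale1 jscaleDr jscaleDl.

Definition oct_seq (x : oct K) : seq K :=
  [:: qc0 x.1; qc1 x.1; qc2 x.1; qc3 x.1; qc0 x.2; qc1 x.2; qc2 x.2; qc3 x.2].
Definition jordan_seq X : seq K :=
  [:: jxi1 X; jxi2 X; jxi3 X]
    ++ oct_seq (jx1 X) ++ oct_seq (jx2 X) ++ oct_seq (jx3 X).
Definition jordan_row X : 'rV[K]_27 := \row_(i < 27) (jordan_seq X)`_i.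
Definition row_jordan (v : 'rV[K]_27) : jordan K :=
  let c k := v 0 (inord k) in
  let o k := (Quat (c k) (c k.+1) (c k.+2) (c k.+3),
              Quat (c k.+4) (c k.+4.+1) (c k.+4.+2) (c k.+4.+3)) in
  Jordan (c 0%N) (c 1%N) (c 2%N) (o 3%N) (o 11%N) (o 19%N).

Fact jordan_vect : Vector.axiom 27 (jordan K).
Proof.
exists jordan_row => [a X Y|].
  by apply/rowP => -[i hi]; rewrite !mxE /=; do 27?[case: i hi => [|i] hi //=].
exists row_jordan => [[a1 a2 a3 [[? ? ? ?] [? ? ? ?]] [[? ? ? ?] [? ? ? ?]]
                       [[? ? ? ?] [? ? ? ?]]]|v].
  by rewrite /row_jordan !mxE !inordK.
apply/rowP => i; rewrite !mxE.
have -> : jordan_seq (row_jordan v) = [seq v 0 (inord k) | k <- iota 0 27] by [].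
by rewrite (nth_map 0%N) ?size_iota // nth_iota // inord_val.
Qed.
HB.instance Definition _ := Lmodule_hasFinDim.Build K (jordan K) jordan_vect.

End JordanModule.

HB.instance Definition _ (K : numFieldType) := Topological.copy (quat K)
  (initial_topology (@quat_tuple K : quat K -> (K * K * K * K)%type)).
HB.instance Definition _ (K : numFieldType) := Topological.copy (jordan K)
  (initial_topology (@jordan_tuple K)).

Section Algebra.
Variable K : numFieldType.
Implicit Types (p q : quat K) (x y : oct K) (X Y : jordan K).

Definition qmul p q : quat K :=
  let: Quat a0 a1 a2 a3 := p in
  let: Quat b0 b1 b2 b3 := q in
  Quat (a0 * b0 - a1 * b1 - a2 * b2 - a3 * b3)
       (a0 * b1 + a1 * b0 + a2 * b3 - a3 * b2)
       (a0 * b2 - a1 * b3 + a2 * b0 + a3 * b1)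
       (a0 * b3 + a1 * b2 - a2 * b1 + a3 * b0).

Definition qconj p : quat K := Quat (qc0 p) (- qc1 p) (- qc2 p) (- qc3 p).

Definition omul x y : oct K :=
  let: (m, n) := x in
  let: (p, q) := y in
  (qmul m p - qmul (qconj q) n, qmul n (qconj p) + qmul q m).

Definition oconj x : oct K := (qconj x.1, - x.2).

Definition oreal x : K := qc0 x.1.

Definition oscal (a : K) : oct K := (Quat a 0 0 0, 0).

Definition omulmx (A B : 'M[oct K]_3) : 'M[oct K]_3 :=
  \matrix_(i, j) \sum_(k < 3) omul (A i k) (B k j).

Definition oadjmx (A : 'M[oct K]_3) : 'M[oct K]_3 :=
  \matrix_(i, j) oconj (A j i).

Definition hmx X : 'M[oct K]_3 :=
  let: Jordan xi1 xi2 xi3 x1 x2 x3 := X in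
  let rows := [:: [:: oscal xi1;   x3;         oconj x2 ];
                  [:: oconj x3;    oscal xi2;  x1       ];
                  [:: x2;          oconj x1;   oscal xi3]] in
  \matrix_(i < 3, j < 3) nth 0 (nth [::] rows i) j.

Definition hcoord (A : 'M[oct K]_3) : jordan K :=
  Jordan (oreal (A 0 0)) (oreal (A 1 1)) (oreal (A 2 2)) (A 1 2) (A 2 0) (A 0 1).

(* XY + YX is Hermitian (see [hmx_jmul]), so reading off its coordinates loses
   nothing. *)
Definition jmul X Y : jordan K :=
  2^-1 *: hcoord (omulmx (hmx X) (hmx Y) + omulmx (hmx Y) (hmx X)).

Definition jtr X : K := jxi1 X + jxi2 X + jxi3 X.

Definition junit : jordan K := Jordan 1 1 1 0 0 0.

Definition jinner X Y : K := jtr (jmul X Y).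

Definition jcross X Y : jordan K :=
  2^-1 *: (2 *: jmul X Y - jtr X *: Y - jtr Y *: X
           + (jtr X * jtr Y - jinner X Y) *: junit).

Definition jdet X : K := 3^-1 * jinner X (jcross X X).

Definition jmap (f : oct K -> oct K) X : jordan K :=
  Jordan (jxi1 X) (jxi2 X) (jxi3 X) (f (jx1 X)) (f (jx2 X)) (f (jx3 X)).

(* The orthogonal projection onto span(1, e1), the copy of the complex numbers
   inside the quaternions. *)
Definition oproj x : oct K := (Quat (qc0 x.1) (qc1 x.1) 0 0, 0).

Definition ogamma (w : quat K) x : oct K := (x.1, qmul w x.2).

(* The complex structure on the orthogonal complement of span(1, e1) is left
   multiplication in the Cayley algebra; for e6 = +-e2 e4 this reads off as
   coordinatewise multiplication on the basis e2, e4, e6. *)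
Definition ow (w : quat K) x : oct K :=
  oproj x + omul (w, 0) (x - oproj x).

Lemma oconjK : involutive oconj.
Proof. by move=> [[? ? ? ?] [? ? ? ?]]; congr (Quat _ _ _ _, Quat _ _ _ _);
  apply: opprK. Qed.

Lemma oconjD : {morph oconj : x y / x + y}.
Proof.
move=> [[? ? ? ?] [? ? ? ?]] [[? ? ? ?] [? ? ? ?]].
by congr (Quat _ _ _ _, Quat _ _ _ _); rewrite /= ?opprD.
Qed.

Lemma oconjZ (a : K) x : oconj (a *: x) = a *: oconj x.
Proof.
move: x => [[? ? ? ?] [? ? ? ?]].
by congr (Quat _ _ _ _, Quat _ _ _ _); rewrite /= ?mulrN.
Qed.

Lemma oconjM x y : oconj (omul x y) = omul (oconj y) (oconj x).
Proof.
move: x y => [[? ? ? ?] [? ? ? ?]] [[? ? ? ?] [? ? ? ?]].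
by congr (Quat _ _ _ _, Quat _ _ _ _); rewrite /=; ring.
Qed.

Lemma oconj_scal (a : K) : oconj (oscal a) = oscal a.
Proof. by congr (Quat _ _ _ _, Quat _ _ _ _); rewrite /= oppr0. Qed.

Lemma oconj_id x : oconj x = x -> x = oscal (oreal x).
Proof.
have N0 (a : K) : - a = a -> a = 0.
  by move=> /esym/eqP; rewrite -addr_eq0 -mulr2n mulrn_eq0 /= => /eqP.
move: x => [[a0 a1 a2 a3] [b0 b1 b2 b3]].
by case=> /N0 -> /N0 -> /N0 -> /N0 -> /N0 -> /N0 -> /N0 ->.
Qed.

Lemma hmx_adj X : oadjmx (hmx X) = hmx X.
Proof.
case: X => a b c x1 x2 x3; apply/matrixP => i j; rewrite !mxE.
by case: i => [[|[|[|i]]]] // hi; case: j => [[|[|[|j]]]] // hj;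
  rewrite /= ?oconjK ?oconj_scal.
Qed.

Lemma hmxK : cancel hmx hcoord.
Proof. by case=> a b c x1 x2 x3; rewrite /hcoord !mxE. Qed.

(* The matrices [hmx X] are exactly the Hermitian ones. *)
Lemma hmxP (A : 'M[oct K]_3) : oadjmx A = A <-> hmx (hcoord A) = A.
Proof.
split=> [hA|<-]; last exact: hmx_adj.
have hAij i j : oconj (A j i) = A i j by rewrite -{2}hA mxE.
have E0 i j (i' j' : 'I_3) : i = i' -> j = j' -> A i j = A i' j' by move=> -> ->.
apply/matrixP => i j; rewrite !mxE.
case: i => [[|[|[|i]]]] // hi; case: j => [[|[|[|j]]]] // hj;
  rewrite /= ?hAij -?oconj_id ?hAij //; by apply: E0; apply: val_inj.
Qed.

Lemma oadjmxM (A B : 'M[oct K]_3) :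
  oadjmx (omulmx A B) = omulmx (oadjmx B) (oadjmx A).
Proof.
apply/matrixP => i j; rewrite !mxE.
rewrite (big_morph oconj oconjD (oconj_scal 0)).
by apply: eq_bigr => k _; rewrite !mxE oconjM.
Qed.

Lemma hmx_jmul X Y :
  hmx (jmul X Y) =
  \matrix_(i, j) (2^-1 *: (omulmx (hmx X) (hmx Y) + omulmx (hmx Y) (hmx X)) i j).
Proof.
set M := _ + _.
have adjE (P Q : jordan K) i j :
    oconj (omulmx (hmx P) (hmx Q) j i) = omulmx (hmx Q) (hmx P) i j.
  by have /matrixP/(_ i j) := oadjmxM (hmx P) (hmx Q); rewrite !hmx_adj mxE.
have hM : hmx (hcoord M) = M.
  apply/hmxP; rewrite /M; apply/matrixP => i j.
  by rewrite [LHS]mxE [in LHS]mxE oconjD !adjE addrC [RHS]mxE.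
rewrite -{1}hM /jmul -/M; case: (hcoord M) => a b c x1 x2 x3.
have Z0 (r s : K) : r *: oscal s = oscal (r * s).
  by congr (Quat _ _ _ _, Quat _ _ _ _); rewrite /= mulr0.
apply/matrixP => i j; rewrite !mxE.
by case: i => [[|[|[|i]]]] // hi; case: j => [[|[|[|j]]]] // hj;
  rewrite /= ?oconjZ ?Z0.
Qed.

End Algebra.

(* A linear automorphism of the Cayley algebra commuting with the conjugation
   induces a map preserving all the structure of the Jordan algebra. *)
Section JordanMap.
Variables (K : numFieldType) (f : oct K -> oct K).
Hypotheses (f_lin : linear f) (fM : {morph f : x y / omul x y}).
Hypotheses (fJ : forall x, f (oconj x) = oconj (f x)).
Hypotheses (f_re : forall x, oreal (f x) = oreal x).
Hypotheses (f_scal : forall a, f (oscal a) = oscal a).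

Lemma jmap_linear : linear (jmap f).
Proof. by move=> a X Y; congr Jordan; apply: f_lin. Qed.

Let f0 : f 0 = 0.
Proof. by have := f_lin (-1) 0 0; rewrite !scaleN1r !addNr. Qed.

Let fD x y : f (x + y) = f x + f y.
Proof. by have := f_lin 1 x y; rewrite !scale1r. Qed.

Let fZ a x : f (a *: x) = a *: f x.
Proof. by have := f_lin a x 0; rewrite f0 !addr0. Qed.

Let jZ a X : jmap f (a *: X) = a *: jmap f X.
Proof. by congr Jordan; apply: fZ. Qed.

Let jD X Y : jmap f (X + Y) = jmap f X + jmap f Y.
Proof. by congr Jordan; apply: fD. Qed.

Let hmx_jmap X : hmx (jmap f X) = map_mx f (hmx X).
Proof.
case: X => a b c x1 x2 x3; apply/matrixP => i j; rewrite !mxE.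
by case: i => [[|[|[|i]]]] // hi; case: j => [[|[|[|j]]]] // hj;
  rewrite /= ?fJ ?f_scal.
Qed.

Let hcoord_map A : hcoord (map_mx f A) = jmap f (hcoord A).
Proof. by rewrite /hcoord !mxE !f_re. Qed.

Let omulmx_map A B : omulmx (map_mx f A) (map_mx f B) = map_mx f (omulmx A B).
Proof.
apply/matrixP => i j; rewrite !mxE (big_morph f fD f0).
by apply: eq_bigr => k _; rewrite !mxE fM.
Qed.

Lemma jmap_mul X Y : jmul (jmap f X) (jmap f Y) = jmap f (jmul X Y).
Proof.
rewrite /jmul !hmx_jmap !omulmx_map jZ -hcoord_map; congr (_ *: hcoord _).
by apply/matrixP => i j; rewrite !mxE fD.
Qed.

Lemma jmap_inner X Y : jinner (jmap f X) (jmap f Y) = jinner X Y.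
Proof. by rewrite /jinner jmap_mul. Qed.

Lemma jmap_det X : jdet (jmap f X) = jdet X.
Proof.
have junitE : jmap f (junit K) = junit K by rewrite /jmap /junit /= !f0.
have crossE : jcross (jmap f X) (jmap f X) = jmap f (jcross X X).
  rewrite /jcross jZ !(jD, jZ) jmap_mul jmap_inner junitE.
  by rewrite -!scaleNr !jZ.
by rewrite /jdet crossE jmap_inner.
Qed.

End JordanMap.

Section CayleyMaps.
Variable K : numFieldType.

Lemma ogamma_linear (w : quat K) : linear (ogamma w).
Proof.
move: w => [? ? ? ?] a [[? ? ? ?] [? ? ? ?]] [[? ? ? ?] [? ? ? ?]].
by congr (Quat _ _ _ _, Quat _ _ _ _); rewrite /=; ring.
Qed.

Lemma ow_linear (w : quat K) : linear (ow w).
Proof.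
move: w => [? ? ? ?] a [[? ? ? ?] [? ? ? ?]] [[? ? ? ?] [? ? ? ?]].
by congr (Quat _ _ _ _, Quat _ _ _ _); rewrite /=; ring.
Qed.

Lemma ow_coord (a b m0 m1 m2 m3 n0 n1 n2 n3 : K) :
  ow (Quat a b 0 0) (Quat m0 m1 m2 m3, Quat n0 n1 n2 n3) =
  (Quat m0 m1 (a * m2 - b * m3) (a * m3 + b * m2),
   Quat (a * n0 - b * n1) (a * n1 + b * n0) (a * n2 + b * n3) (a * n3 - b * n2)).
Proof. by congr (Quat _ _ _ _, Quat _ _ _ _); rewrite /=; ring. Qed.

Variable s : K.
Hypothesis s_sqr : s ^+ 2 = 3.
Let w : quat K := Quat (- 2^-1) (s / 2) 0 0.

Lemma ogammaM : {morph ogamma w : x y / omul x y}.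
Proof.
move=> [[? ? ? ?] [? ? ? ?]] [[? ? ? ?] [? ? ? ?]].
by congr (Quat _ _ _ _, Quat _ _ _ _); rewrite /=; field: s_sqr;
  rewrite ?pnatr_eq0.
Qed.

Lemma owM : {morph ow w : x y / omul x y}.
Proof.
move=> [[? ? ? ?] [? ? ? ?]] [[? ? ? ?] [? ? ? ?]].
by congr (Quat _ _ _ _, Quat _ _ _ _); rewrite /=; field: s_sqr;
  rewrite ?pnatr_eq0.
Qed.

Lemma ogammaJ x : ogamma w (oconj x) = oconj (ogamma w x).
Proof.
move: x => [[? ? ? ?] [? ? ? ?]].
by congr (Quat _ _ _ _, Quat _ _ _ _); rewrite /=; ring.
Qed.

Lemma owJ x : ow w (oconj x) = oconj (ow w x).
Proof.
move: x => [[? ? ? ?] [? ? ? ?]].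
by congr (Quat _ _ _ _, Quat _ _ _ _); rewrite /=; ring.
Qed.

Lemma ogamma_order3 x : ogamma w (ogamma w (ogamma w x)) = x.
Proof.
move: x => [[? ? ? ?] [? ? ? ?]].
by congr (Quat _ _ _ _, Quat _ _ _ _); rewrite /=; field: s_sqr;
  rewrite ?pnatr_eq0.
Qed.

Lemma ow_order3 x : ow w (ow w (ow w x)) = x.
Proof.
move: x => [[? ? ? ?] [? ? ? ?]].
by congr (Quat _ _ _ _, Quat _ _ _ _); rewrite /=; field: s_sqr;
  rewrite ?pnatr_eq0.
Qed.

Lemma ow_re x : oreal (ow w x) = oreal x.
Proof. by move: x => [[? ? ? ?] [? ? ? ?]]; rewrite /w ow_coord. Qed.

Lemma ogamma_scal a : ogamma w (oscal a) = oscal a.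
Proof. by congr (_, Quat _ _ _ _); rewrite /=; ring. Qed.

Lemma ow_scal a : ow w (oscal a) = oscal a.
Proof. by congr (Quat _ _ _ _, Quat _ _ _ _); rewrite /=; ring. Qed.

End CayleyMaps.

Section LinearIso.
Variables (K : fieldType) (V : vectType K).

Record liso := LIso { liso_val :> 'End(V); _ : lker liso_val == 0%VS }.

HB.instance Definition _ := [isSub for liso_val].
HB.instance Definition _ := [Choice of liso by <:].

Lemma liso_ker (f : liso) : lker f == 0%VS. Proof. by case: f. Qed.

Let lker_mul (f g : liso) : lker (f \o g)%VF == 0%VS.
Proof.
apply/lker0P => u v; rewrite !comp_lfunE.
by move/(lker0P (liso_ker f)); apply: (lker0P (liso_ker g)).
Qed.
Let lker_one : lker (\1%VF : 'End(V)) == 0%VS.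
Proof. by apply/lker0P => u v; rewrite !id_lfunE. Qed.
Let lker_inv (f : liso) : lker (f^-1)%VF == 0%VS.
Proof.
apply/lker0P => u v /(congr1 f).
by rewrite -!comp_lfunE lker0_compfV ?liso_ker // !id_lfunE.
Qed.

Definition liso_mul f g := LIso (lker_mul f g).
Definition liso_one := LIso lker_one.
Definition liso_inv f := LIso (lker_inv f).

Let liso_mulA : associative liso_mul.
Proof. by move=> f g h; apply: val_inj; rewrite /= comp_lfunA. Qed.
Let liso_mul1 : left_id liso_one liso_mul.
Proof. by move=> f; apply: val_inj; rewrite /= comp_lfun1l. Qed.
Let liso_1mul : right_id liso_one liso_mul.
Proof. by move=> f; apply: val_inj; rewrite /= comp_lfun1r. Qed.
Let liso_mulV : left_inverse liso_one liso_inv liso_mul.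
Proof. by move=> f; apply: val_inj; rewrite /= lker0_compVf ?liso_ker. Qed.
Let liso_Vmul : right_inverse liso_one liso_inv liso_mul.
Proof. by move=> f; apply: val_inj; rewrite /= lker0_compfV ?liso_ker. Qed.

HB.instance Definition _ :=
  isGroup.Build liso liso_mulA liso_mul1 liso_1mul liso_mulV liso_Vmul.

End LinearIso.

Section QuotientGroup.
Local Open Scope group_scope.
Local Open Scope quotient_scope.
Variable G : groupType.

Record normalSubgroup := NormalSubgroup {
  nsg_pred :> {pred G};
  nsg_closed : group_closed nsg_pred;
  nsg_normal : forall x y : G, x \in nsg_pred -> x ^ y \in nsg_pred }.

Variable N : normalSubgroup.

Definition coset_rel : rel G := fun x y => x^-1 * y \in N.

Let N1 : 1 \in N. Proof. by case: (nsg_closed N). Qed.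
Let ND x y : x \in N -> y \in N -> x / y \in N.
Proof. by case: (nsg_closed N) => _; apply. Qed.
Let NV x : x \in N -> x^-1 \in N.
Proof. by move=> /(ND N1); rewrite mul1g. Qed.
Let NM x y : x \in N -> y \in N -> x * y \in N.
Proof. by move=> xN /NV/(ND xN); rewrite invgK. Qed.

Let coset_refl : reflexive coset_rel.
Proof. by move=> x; rewrite /coset_rel mulVg. Qed.
Let coset_sym : symmetric coset_rel.
Proof.
by move=> x y; apply/idP/idP => /NV; rewrite /coset_rel invgM invgK.
Qed.
Let coset_trans : transitive coset_rel.
Proof.
by move=> y x z xy yz; have := NM xy yz; rewrite /coset_rel mulgA mulgK.
Qed.

Canonical coset_equiv := EquivRel coset_rel coset_refl coset_sym coset_trans.

Definition quotient_group : Type := {eq_quot coset_rel}.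
HB.instance Definition _ := Choice.on quotient_group.
HB.instance Definition _ := EqQuotient.on quotient_group.

Local Notation Q := quotient_group.
Local Notation pi := (\pi_Q : G -> Q).

Definition quot_mul (X Y : Q) : Q := pi (repr X * repr Y).
Definition quot_one : Q := pi 1.
Definition quot_inv (X : Q) : Q := pi (repr X)^-1.

Let piP x y : reflect (pi x = pi y) (coset_rel x y).
Proof. exact: eqmodP. Qed.

Lemma quot_piM x y : pi (x * y) = quot_mul (pi x) (pi y).
Proof.
apply/piP; rewrite /coset_rel invgM.
have /piP rx : pi x = pi (repr (pi x)) by rewrite reprK.
have /piP ry : pi y = pi (repr (pi y)) by rewrite reprK.
move: (repr (pi x)) (repr (pi y)) rx ry => x' y' rx ry.
have -> : y^-1 * x^-1 * (x' * y') = (x^-1 * x') ^ y * (y^-1 * y').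
  by rewrite conjgE !mulgA mulgK.
by apply: NM => //; apply: nsg_normal.
Qed.

Lemma quot_piV x : pi x^-1 = quot_inv (pi x).
Proof.
apply/piP; rewrite /coset_rel invgK.
have /piP : pi (repr (pi x)) = pi x by rewrite reprK.
move: (repr (pi x)) => y /(nsg_normal y^-1).
by rewrite conjgE invgK mulgA mulVKg.
Qed.

Let quot_mulA : associative quot_mul.
Proof.
elim/quotW=> x; elim/quotW=> y; elim/quotW=> z.
by rewrite -(quot_piM y z) -(quot_piM x y) -(quot_piM x) -(quot_piM _ z) mulgA.
Qed.
Let quot_mul1 : left_id quot_one quot_mul.
Proof. by elim/quotW=> x; rewrite -(quot_piM 1 x) mul1g. Qed.
Let quot_1mul : right_id quot_one quot_mul.
Proof. by elim/quotW=> x; rewrite -(quot_piM x 1) mulg1. Qed.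
Let quot_mulV : left_inverse quot_one quot_inv quot_mul.
Proof. by elim/quotW=> x; rewrite -(quot_piV x) -(quot_piM _ x) mulVg. Qed.
Let quot_Vmul : right_inverse quot_one quot_inv quot_mul.
Proof. by elim/quotW=> x; rewrite -(quot_piV x) -(quot_piM x) mulgV. Qed.

HB.instance Definition _ :=
  isGroup.Build quotient_group quot_mulA quot_mul1 quot_1mul quot_mulV quot_Vmul.

End QuotientGroup.

Section UnitaryGroups.
Variable C : numClosedFieldType.
Local Open Scope sesquilinear_scope.

Record U1 := U1Make { U1_val : C; _ : `|U1_val| == 1 }.
HB.instance Definition _ := [isSub for U1_val].
HB.instance Definition _ := [Choice of U1 by <:].

Lemma U1_norm (z : U1) : `|U1_val z| = 1. Proof. by case: z => z /= /eqP. Qed.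

Let U1_mulP (z t : U1) : `|U1_val z * U1_val t| == 1.
Proof. by rewrite normrM !U1_norm mulr1. Qed.
Let U1_oneP : `|1 : C| == 1. Proof. by rewrite normr1. Qed.
Let U1_invP (z : U1) : `|(U1_val z)^-1| == 1.
Proof. by rewrite normfV U1_norm invr1. Qed.

Definition U1_mul z t := U1Make (U1_mulP z t).
Definition U1_one := U1Make U1_oneP.
Definition U1_inv z := U1Make (U1_invP z).

Let U1_mulA : associative U1_mul.
Proof. by move=> x y z; apply: val_inj; rewrite /= mulrA. Qed.
Let U1_mul1 : left_id U1_one U1_mul.
Proof. by move=> x; apply: val_inj; rewrite /= mul1r. Qed.
Let U1_1mul : right_id U1_one U1_mul.
Proof. by move=> x; apply: val_inj; rewrite /= mulr1. Qed.
Let U1_neq0 (z : U1) : U1_val z != 0.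
Proof. by rewrite -normr_eq0 U1_norm oner_eq0. Qed.
Let U1_mulV : left_inverse U1_one U1_inv U1_mul.
Proof. by move=> x; apply: val_inj; rewrite /= mulVf. Qed.
Let U1_Vmul : right_inverse U1_one U1_inv U1_mul.
Proof. by move=> x; apply: val_inj; rewrite /= mulfV. Qed.

HB.instance Definition _ :=
  isGroup.Build U1 U1_mulA U1_mul1 U1_1mul U1_mulV U1_Vmul.

Record SU3 := SU3Make {
  SU3_val :> 'M[C]_3; _ : (SU3_val \is unitarymx) && (\det SU3_val == 1) }.
HB.instance Definition _ := [isSub for SU3_val].
HB.instance Definition _ := [Choice of SU3 by <:].

Lemma SU3_unitary (A : SU3) : (A : 'M[C]_3) \is unitarymx.
Proof. by case: A => A /= /andP[]. Qed.
Lemma SU3_det (A : SU3) : \det A = 1.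
Proof. by case: A => A /= /andP[_ /eqP]. Qed.

Let SU3_mulP (A B : SU3) : (A *m B \is unitarymx) && (\det (A *m B) == 1).
Proof. by rewrite mul_unitarymx ?SU3_unitary // det_mulmx !SU3_det mulr1 /=. Qed.
Let SU3_oneP : ((1%:M : 'M[C]_3) \is unitarymx) && (\det (1%:M : 'M[C]_3) == 1).
Proof.
rewrite det1 eqxx andbT; apply/unitarymxP.
by rewrite trmx1 map_mx1 mulmx1.
Qed.
Let SU3_invP (A : SU3) : (invmx A \is unitarymx) && (\det (invmx A) == 1).
Proof.
by rewrite {1}invmx_unitary ?trmxC_unitary ?SU3_unitary // det_inv SU3_det invr1 /=.
Qed.

Definition SU3_mul A B := SU3Make (SU3_mulP A B).
Definition SU3_one := SU3Make SU3_oneP.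
Definition SU3_inv A := SU3Make (SU3_invP A).

Let SU3_mulA : associative SU3_mul.
Proof. by move=> x y z; apply: val_inj; rewrite /= mulmxA. Qed.
Let SU3_mul1 : left_id SU3_one SU3_mul.
Proof. by move=> x; apply: val_inj; rewrite /= mul1mx. Qed.
Let SU3_1mul : right_id SU3_one SU3_mul.
Proof. by move=> x; apply: val_inj; rewrite /= mulmx1. Qed.
Let SU3_unit (A : SU3) : (A : 'M[C]_3) \in unitmx.
Proof. by rewrite unitmxE SU3_det unitr1. Qed.
Let SU3_mulV : left_inverse SU3_one SU3_inv SU3_mul.
Proof. by move=> x; apply: val_inj; rewrite /= mulVmx. Qed.
Let SU3_Vmul : right_inverse SU3_one SU3_inv SU3_mul.
Proof. by move=> x; apply: val_inj; rewrite /= mulmxV. Qed.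

HB.instance Definition _ :=
  isGroup.Build SU3 SU3_mulA SU3_mul1 SU3_1mul SU3_mulV SU3_Vmul.

End UnitaryGroups.

HB.instance Definition _ (C : numClosedFieldType) :=
  Topological.copy (U1 C) (initial_topology (@U1_val C)).
HB.instance Definition _ (C : numClosedFieldType) :=
  Topological.copy (SU3 C) (initial_topology (@SU3_val C)).

Section E6.
Variable C : numClosedFieldType.
Local Notation J := (jordan C).

Definition qtau (p : quat C) : quat C :=
  Quat (qc0 p)^* (qc1 p)^* (qc2 p)^* (qc3 p)^*.

Definition otau (x : oct C) : oct C := (qtau x.1, qtau x.2).

Definition jtau (X : J) : J :=
  Jordan (jxi1 X)^* (jxi2 X)^* (jxi3 X)^*
         (otau (jx1 X)) (otau (jx2 X)) (otau (jx3 X)).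

Definition jherm (X Y : J) : C := jinner (jtau X) Y.

Definition in_E6 : {pred liso J} := fun a =>
  `[< (forall X, jdet (a X) = jdet X) /\
      (forall X Y, jherm (a X) (a Y) = jherm X Y) >].

Lemma in_E6P (a : liso J) :
  reflect ((forall X, jdet (a X) = jdet X) /\
           (forall X Y, jherm (a X) (a Y) = jherm X Y)) (a \in in_E6).
Proof. exact: asboolP. Qed.

Fact in_E6_group_closed : group_closed in_E6.
Proof.
split=> [|a b /in_E6P[aD aH] /in_E6P[bD bH]].
  by apply/in_E6P; split=> [X|X Y]; rewrite !id_lfunE.
have bK X : b ((b^-1)%g X) = X.
  by rewrite -comp_lfunE lker0_compfV ?liso_ker // id_lfunE.
apply/in_E6P; split=> [X|X Y]; rewrite !comp_lfunE.
  by rewrite aD -bD bK.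
by rewrite aH -bH !bK.
Qed.

Record E6 := E6Make { E6_val :> liso J; _ : E6_val \in in_E6 }.
HB.instance Definition _ := [isSub for E6_val].
HB.instance Definition _ := [Choice of E6 by <:].
HB.instance Definition _ :=
  SubChoice_isSubGroup.Build (liso J) in_E6 E6 in_E6_group_closed.

Let s : C := sqrtC 3.

Let s_sqr : s ^+ 2 = 3. Proof. exact: sqrtCK. Qed.

Let s_conj : s^* = s.
Proof. by rewrite geC0_conj // sqrtC_ge0 ler0n. Qed.

(* The cube root of unity -1/2 + (sqrt 3 / 2) e1 of span(1, e1); sqrtC 3 is the
   positive square root. *)
Definition bomega : quat C := Quat (- 2^-1) (sqrtC 3 / 2) 0 0.

Let s2_conj : (s / 2)^* = s / 2.
Proof. by rewrite rmorphM fmorphV rmorph_nat /= s_conj. Qed.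

Let half_conj : (2^-1 : C)^* = 2^-1.
Proof. by rewrite fmorphV rmorph_nat. Qed.

Let ogamma_tau_real (a b : C) x : a^* = a -> b^* = b ->
  otau (ogamma (Quat a b 0 0) x) = ogamma (Quat a b 0 0) (otau x).
Proof.
move: x => [[? ? ? ?] [? ? ? ?]] ha hb.
by congr (Quat _ _ _ _, Quat _ _ _ _);
  rewrite /= ?(rmorphB, rmorphD, rmorphM, rmorphN, rmorph0) /= ?ha ?hb.
Qed.

Let ow_tau_real (a b : C) x : a^* = a -> b^* = b ->
  otau (ow (Quat a b 0 0) x) = ow (Quat a b 0 0) (otau x).
Proof.
move: x => [[? ? ? ?] [? ? ? ?]] ha hb.
by congr (Quat _ _ _ _, Quat _ _ _ _);
  rewrite /= ?(rmorphB, rmorphD, rmorphM, rmorphN, rmorph0) /= ?ha ?hb.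
Qed.

Let mhalf_conj : (- 2^-1 : C)^* = - 2^-1.
Proof. by rewrite rmorphN /= half_conj. Qed.

Lemma ogamma_tau x : otau (ogamma bomega x) = ogamma bomega (otau x).
Proof. exact: ogamma_tau_real. Qed.

Lemma ow_tau x : otau (ow bomega x) = ow bomega (otau x).
Proof. exact: ow_tau_real. Qed.

Lemma jmap_tau (f : oct C -> oct C) (fT : forall x, otau (f x) = f (otau x)) X :
  jtau (jmap f X) = jmap f (jtau X).
Proof. by congr Jordan; apply: fT. Qed.

Definition gamma3_map : J -> J := jmap (ogamma bomega).
Definition w3_map : J -> J := jmap (ow bomega).
HB.instance Definition _ := GRing.isLinear.Build C J J _ gamma3_map
  (jmap_linear (ogamma_linear bomega)).
HB.instance Definition _ := GRing.isLinear.Build C J J _ w3_map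
  (jmap_linear (ow_linear bomega)).

Fact gamma3_ker : lker (linfun gamma3_map) == 0%VS.
Proof.
apply/lker0P; apply: (can_inj (g := gamma3_map \o gamma3_map)) => X.
by rewrite lfunE; case: X => *; congr Jordan; apply: ogamma_order3.
Qed.

Fact w3_ker : lker (linfun w3_map) == 0%VS.
Proof.
apply/lker0P; apply: (can_inj (g := w3_map \o w3_map)) => X.
by rewrite lfunE; case: X => *; congr Jordan; apply: ow_order3.
Qed.

Fact gamma3_in_E6 : LIso gamma3_ker \in in_E6.
Proof.
have fM := ogammaM s_sqr; have fL := ogamma_linear bomega.
have fJ := ogammaJ s; have fS := ogamma_scal s.
apply/in_E6P; split=> [X|X Y]; rewrite !lfunE /=; first exact: jmap_det.
by rewrite /jherm (jmap_tau ogamma_tau); exact: jmap_inner.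
Qed.

Fact w3_in_E6 : LIso w3_ker \in in_E6.
Proof.
have fM := owM s_sqr; have fL := ow_linear bomega.
have fJ := owJ s; have fS := ow_scal s; have fR := ow_re s.
apply/in_E6P; split=> [X|X Y]; rewrite !lfunE /=; first exact: jmap_det.
by rewrite /jherm (jmap_tau ow_tau); exact: jmap_inner.
Qed.

Definition gamma3 : E6 := E6Make gamma3_in_E6.
Definition w3 : E6 := E6Make w3_in_E6.

Definition E6_fix (g : E6) : {pred E6} := fun a => (g^-1 * a * g == a)%g.

Definition in_E6_gamma3_w3 : {pred E6} := [predI E6_fix gamma3 & E6_fix w3].

Fact E6_gamma3_w3_group_closed : group_closed in_E6_gamma3_w3.
Proof.
have fixE g a : (a \in E6_fix g) = (a ^ g == a)%g.
  by rewrite unfold_in conjgE mulgA.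
have fix1 g : 1%g \in E6_fix g by rewrite fixE conj1g.
have fixF g a b : a \in E6_fix g -> b \in E6_fix g -> (a / b)%g \in E6_fix g.
  by rewrite !fixE => /eqP ha /eqP hb; rewrite conjMg conjVg ha hb.
split=> [|a b]; first by rewrite inE !fix1.
by rewrite !inE => /andP[a1 a2] /andP[b1 b2]; rewrite !fixF.
Qed.

Record E6_gamma3_w3 := E6gwMake {
  E6gw_val :> E6; _ : E6gw_val \in in_E6_gamma3_w3 }.
HB.instance Definition _ := [isSub for E6gw_val].
HB.instance Definition _ := [Choice of E6_gamma3_w3 by <:].
HB.instance Definition _ := SubChoice_isSubGroup.Build
  E6 in_E6_gamma3_w3 E6_gamma3_w3 E6_gamma3_w3_group_closed.



End E6.

(* Linear isomorphisms carry the topology of pointwise convergence, which in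
   finite dimension is the usual one; subgroups carry the induced topology. *)
HB.instance Definition _ (C : numClosedFieldType) :=
  Topological.copy (liso (jordan C))
    (initial_topology (fun a : liso (jordan C) =>
       (fun X => a X) : {ptws jordan C -> jordan C})).
HB.instance Definition _ (C : numClosedFieldType) :=
  Topological.copy (E6 C) (initial_topology (@E6_val C)).
HB.instance Definition _ (C : numClosedFieldType) :=
  Topological.copy (E6_gamma3_w3 C) (initial_topology (@E6gw_val C)).

Section Kernel.
Variable C : numClosedFieldType.
Local Open Scope sesquilinear_scope.

(* The cube root of unity among the scalars, as opposed to [bomega]. *)
Definition omega : C := - 2^-1 + sqrtC 3 / 2 * 'i.

Let omegaE : omega^* = - 2^-1 - sqrtC 3 / 2 * 'i.
Proof.
rewrite rmorphD rmorphN rmorphM rmorphM !fmorphV !rmorph_nat /= conjCi mulrN.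
by rewrite geC0_conj // sqrtC_ge0 ler0n.
Qed.

Let omegaJ : omega * omega^* = 1.
Proof.
have s2 : sqrtC 3 ^+ 2 = 3 :> C := sqrtCK 3.
have i2 : 'i ^+ 2 = -1 :> C := sqrCi C.
by rewrite omegaE /omega; field: s2 i2; rewrite ?pnatr_eq0.
Qed.

Let omega3 : omega ^+ 3 = 1.
Proof.
have s2 : sqrtC 3 ^+ 2 = 3 :> C := sqrtCK 3.
have i2 : 'i ^+ 2 = -1 :> C := sqrCi C.
by rewrite /omega; field: s2 i2; rewrite ?pnatr_eq0.
Qed.

Fact omega_U1 : `|omega| == 1.
Proof. by rewrite -(@pexpr_eq1 _ _ 2) // normCK omegaJ. Qed.

Fact omega_SU3 :
  ((omega%:M : 'M[C]_3) \is unitarymx) && (\det (omega%:M : 'M[C]_3) == 1).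
Proof.
rewrite det_scalar omega3 eqxx andbT; apply/unitarymxP.
by rewrite tr_scalar_mx map_scalar_mx -scalar_mxM omegaJ.
Qed.

Fact N1_U1 : `|-1 : C| == 1. Proof. by rewrite normrN1. Qed.

Definition U1_omega : U1 C := U1Make omega_U1.
Definition U1_N1 : U1 C := U1Make N1_U1.
(* The scalar matrix omega E; its inverse in SU(3) is omega^-1 E. *)
Definition SU3_omega : SU3 C := SU3Make omega_SU3.

Local Notation G := (U1 C * U1 C * SU3 C * SU3 C)%type.

Local Open Scope group_scope.
Definition Z2 : seq G := [:: (1, 1, 1, 1); (U1_N1, U1_N1, 1, 1)].
Definition Z3 : seq G :=
  [:: (1, 1, 1, 1);
      (1, U1_omega, SU3_omega^-1, SU3_omega);
      (1, U1_omega^-1, SU3_omega, SU3_omega^-1)].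
(* Z2 and Z3 are central and meet trivially, so their direct product is the
   subgroup of the products z2 z3. *)
Definition in_Z2Z3 : {pred G} := fun x => x \in [seq a * b | a <- Z2, b <- Z3].

Let U1C (z t : U1 C) : commute z t.
Proof. by apply: val_inj; apply: mulrC. Qed.

Let omegaC (A : SU3 C) : commute SU3_omega A.
Proof. by apply: val_inj; rewrite /= scalar_mxC. Qed.

Let omegaVC (A : SU3 C) : commute SU3_omega^-1 A.
Proof. exact/commute_sym/commuteV/commute_sym/omegaC. Qed.

Let pairC (x y : G) : commute x.1.1.1 y.1.1.1 -> commute x.1.1.2 y.1.1.2 ->
  commute x.1.2 y.1.2 -> commute x.2 y.2 -> commute x y.
Proof.
move: x y => [[[? ?] ?] ?] [[[? ?] ?] ?] /= h1 h2 h3 h4.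
by congr (_, _, _, _).
Qed.

Let Z2C a x : a \in Z2 -> commute a x.
Proof.
rewrite !inE => /orP[] /eqP ->; apply: pairC; rewrite /= ;
  by [exact: U1C|exact/commute_sym/commute1].
Qed.

Let Z3C b x : b \in Z3 -> commute b x.
Proof.
rewrite !inE => /or3P[] /eqP ->; apply: pairC; rewrite /= ;
  by [exact: U1C|exact/commute_sym/commute1|exact: omegaC|exact: omegaVC].
Qed.

Let N1K : U1_N1 * U1_N1 = 1.
Proof. by apply: val_inj; rewrite /= mulrNN mulr1. Qed.

Let U1_omega3 : U1_omega * U1_omega = U1_omega^-1.
Proof.
apply: (mulIg U1_omega); rewrite mulVg; apply: val_inj.
by rewrite /= -omega3 !exprS expr0 mulr1 mulrA.
Qed.

Let SU3_omega3 : SU3_omega * SU3_omega = SU3_omega^-1.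
Proof.
apply: (mulIg SU3_omega); rewrite mulVg; apply: val_inj.
by rewrite /= -!scalar_mxM -omega3 !exprS expr0 mulr1 mulrA.
Qed.

Let divE a b c d a' b' c' d' :
  ((a, b, c, d) : G) / (a', b', c', d') = (a / a', b / b', c / c', d / d').
Proof. by []. Qed.

Let Z2F a b : a \in Z2 -> b \in Z2 -> a / b \in Z2.
Proof.
have N1V : U1_N1^-1 = U1_N1 by apply: (mulIg U1_N1); rewrite mulVg N1K.
by rewrite !inE => /orP[] /eqP -> /orP[] /eqP ->;
  rewrite divE ?invg1 ?N1V ?mulg1 ?mul1g ?N1K eqxx ?orbT.
Qed.

Let Z3F a b : a \in Z3 -> b \in Z3 -> a / b \in Z3.
Proof.
have inv2 (H : groupType) (x : H) : x * x = x^-1 -> x^-1 * x^-1 = x.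
  by move=> h; rewrite -invgM h invgK.
have [u2 S2] := (inv2 _ _ U1_omega3, inv2 _ _ SU3_omega3).
by rewrite !inE => /or3P[] /eqP -> /or3P[] /eqP ->;
  rewrite divE ?invg1 ?invgK ?mulg1 ?mul1g ?mulgV ?mulVg ?U1_omega3 ?SU3_omega3
    ?u2 ?S2 eqxx ?orbT.
Qed.

Lemma in_Z2Z3P x :
  reflect (exists p, [/\ p.1 \in Z2, p.2 \in Z3 & x = p.1 * p.2])
          (x \in in_Z2Z3).
Proof. exact: allpairsP. Qed.

Fact Z2Z3_group_closed : group_closed in_Z2Z3.
Proof.
split=> [|x y /in_Z2Z3P[[a b] /= [aZ bZ ->]] /in_Z2Z3P[[c d] /= [cZ dZ ->]]].
  by apply/in_Z2Z3P; exists (1, 1); rewrite !inE !eqxx mulg1.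
apply/in_Z2Z3P; exists (a / c, b / d); split; [exact: Z2F|exact: Z3F|].
have cV : commute (b * d^-1) c^-1 by exact/commuteV/commute_sym/Z2C.
by rewrite /= invgM -[LHS]mulgA (mulgA b) cV !mulgA.
Qed.

Fact Z2Z3_normal (x y : G) : x \in in_Z2Z3 -> x ^ y \in in_Z2Z3.
Proof.
move=> xN; have /in_Z2Z3P[[a b] /= [aZ bZ xE]] := xN.
suff yx : commute y x by rewrite conjgE -yx mulKg.
rewrite xE; apply: commuteM; apply: commute_sym; [exact: Z2C|exact: Z3C].
Qed.

Definition Z2Z3 : normalSubgroup G :=
  NormalSubgroup Z2Z3_group_closed Z2Z3_normal.

End Kernel.

Definition cplx (R : realType) : numClosedFieldType := R[i].

(* Main.v *)
(* Over the complex numbers the joint eigenspaces of gamma_3 and w_3 split J^C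
   into a copy of M(3,C) (the joint fixed space) and six copies of C^3, giving
   coordinates (M, b, c) in M(3,C)^3, where the columns of b and of c lie in six
   different eigenspaces.  In them
     det X = det M - det b - det c - tr (c^T M b),
   and the Hermitian form is the standard one.  An element of E_6 commuting with
   gamma_3 and w_3 preserves every eigenspace, so it acts on the columns b_j, c_j
   by unitary matrices U_j, V_j; invariance of the coefficient c_j^T M b_j of det
   then forces M |-> conj(V_j) M U_j^* for each j = 1, 2, 3.  Comparing different
   j, the U_j are scalar multiples m_j U_1, and V_j = conj(m_j) V_1.  The cubes
   det b and det c fix the determinants, and a cube root and a square root turn
   these data into an element (s, t, A, B) acting by
     M |-> conj(B) M A^*,   b |-> A b D,   c |-> B c D^-1,
   with D = diag(st, t/s, t^-2).  The resulting bijection is a homeomorphism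
   because its source is compact and its target is Hausdorff. *)

From HB Require Import structures.
Require Import Defs.
From mathcomp Require Import all_boot all_order all_algebra complex.
From mathcomp Require Import boolp classical_sets reals topology normedtype.
From mathcomp Require Import generic_quotient spectral ring lra.

Set Implicit Arguments.
Unset Strict Implicit.
Unset Printing Implicit Defensive.

Import Order.TTheory GRing.Theory Num.Theory Num.Def.
Local Open Scope ring_scope.
Local Open Scope sesquilinear_scope.
Local Notation "M ^ phi" := (map_mx phi M) : ring_scope.

(** * The determinant and the inner product of the Jordan algebra *)

Section Det.
Variable K : numFieldType.

Definition odot (x y : oct K) : K :=
  qc0 x.1 * qc0 y.1 + qc1 x.1 * qc1 y.1 + qc2 x.1 * qc2 y.1 + qc3 x.1 * qc3 y.1
  + (qc0 x.2 * qc0 y.2 + qc1 x.2 * qc1 y.2 + qc2 x.2 * qc2 y.2 + qc3 x.2 * qc3 y.2).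

Ltac oct_ring := by congr (Quat _ _ _ _, Quat _ _ _ _); rewrite /=; ring.

Lemma omul_scall (a : K) x : omul (oscal a) x = a *: x.
Proof. move: x => [[? ? ? ?] [? ? ? ?]]; oct_ring. Qed.

Lemma omul_scalr (a : K) x : omul x (oscal a) = a *: x.
Proof. move: x => [[? ? ? ?] [? ? ? ?]]; oct_ring. Qed.

Lemma orealD : {morph @oreal K : x y / x + y}. Proof. by []. Qed.

Lemma orealZ (a : K) x : oreal (a *: x) = a * oreal x. Proof. by []. Qed.

Lemma oreal_mulJr (x y : oct K) : oreal (omul x (oconj y)) = odot x y.
Proof.
move: x y => [[? ? ? ?] [? ? ? ?]] [[? ? ? ?] [? ? ? ?]].
by rewrite /oreal /odot /=; ring.
Qed.

Lemma oreal_mulJl (x y : oct K) : oreal (omul (oconj x) y) = odot x y.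
Proof.
move: x y => [[? ? ? ?] [? ? ? ?]] [[? ? ? ?] [? ? ? ?]].
by rewrite /oreal /odot /=; ring.
Qed.

Lemma odotC x y : odot x y = odot y x.
Proof. by rewrite /odot; ring. Qed.

Lemma odot0r x : odot x 0 = 0.
Proof. by rewrite /odot /=; ring. Qed.

Lemma odotNr x y : odot x (- y) = - odot x y.
Proof. by rewrite /odot /=; ring. Qed.

Lemma odotDr x y z : odot x (y + z) = odot x y + odot x z.
Proof. by rewrite /odot /=; ring. Qed.

Lemma odotZr a x y : odot x (a *: y) = a * odot x y.
Proof. by rewrite /odot /=; ring. Qed.

Lemma orealscal a : oreal (oscal a : oct K) = a. Proof. by []. Qed.

(** Both sides are values of the trilinear form Re(x(yz)), which is invariant under cyclic
    permutation although the product is not associative. *)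
Lemma odot_mulC x y z :
  odot x (oconj (omul y z)) = odot y (oconj (omul z x)).
Proof.
move: x y z => [[? ? ? ?] [? ? ? ?]] [[? ? ? ?] [? ? ? ?]]
  [[? ? ? ?] [? ? ? ?]].
by rewrite /odot /=; ring.
Qed.

Lemma octP (x y : oct K) :
  qc0 x.1 = qc0 y.1 -> qc1 x.1 = qc1 y.1 ->
  qc2 x.1 = qc2 y.1 -> qc3 x.1 = qc3 y.1 ->
  qc0 x.2 = qc0 y.2 -> qc1 x.2 = qc1 y.2 ->
  qc2 x.2 = qc2 y.2 -> qc3 x.2 = qc3 y.2 -> x = y.
Proof.
move: x y => [[? ? ? ?] [? ? ? ?]] [[? ? ? ?] [? ? ? ?]] /=.
by do 8!move=> ->.
Qed.

(** Products and conjugates of Cayley numbers stay folded, so that the Jordan product is computed in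
    terms of [odot], [omul] and [oconj] and not in 27 coordinates. *)
Local Arguments omul : simpl never.
Local Arguments oconj : simpl never.

Lemma jmulE (a1 a2 a3 b1 b2 b3 : K) x1 x2 x3 y1 y2 y3 :
  jmul (Jordan a1 a2 a3 x1 x2 x3) (Jordan b1 b2 b3 y1 y2 y3) =
  Jordan (a1 * b1 + odot x2 y2 + odot x3 y3)
         (a2 * b2 + odot x3 y3 + odot x1 y1)
         (a3 * b3 + odot x1 y1 + odot x2 y2)
    (2^-1 *: ((a2 + a3) *: y1 + (b2 + b3) *: x1
              + oconj (omul x2 y3 + omul y2 x3)))
    (2^-1 *: ((a3 + a1) *: y2 + (b3 + b1) *: x2
              + oconj (omul x3 y1 + omul y3 x1)))
    (2^-1 *: ((a1 + a2) *: y3 + (b1 + b2) *: x3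
              + oconj (omul x1 y2 + omul y1 x2))).
Proof.
rewrite /jmul /hcoord !mxE !big_ord_recr !big_ord0 !mxE [in LHS]/=.
rewrite !add0r !(orealD, oreal_mulJr, oreal_mulJl, omul_scall, omul_scalr,
  =^~ oconjM, orealZ, orealscal).
rewrite ?(odotC y1) ?(odotC y2) ?(odotC y3) !oconjD.
congr Jordan; [by rewrite /=; field|by rewrite /=; field|by rewrite /=; field|..].
all: by apply octP; rewrite /=; ring.
Qed.

Lemma jinnerE (X Y : jordan K) : jinner X Y =
  jxi1 X * jxi1 Y + jxi2 X * jxi2 Y + jxi3 X * jxi3 Y +
  2 * (odot (jx1 X) (jx1 Y) + odot (jx2 X) (jx2 Y) + odot (jx3 X) (jx3 Y)).
Proof.
by case: X Y => ? ? ? ? ? ? [? ? ? ? ? ?]; rewrite /jinner jmulE /jtr /=; ring.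
Qed.

Lemma jdetE (X : jordan K) : jdet X = jxi1 X * jxi2 X * jxi3 X
  - jxi1 X * odot (jx1 X) (jx1 X) - jxi2 X * odot (jx2 X) (jx2 X)
  - jxi3 X * odot (jx3 X) (jx3 X)
  + 2 * odot (jx1 X) (oconj (omul (jx2 X) (jx3 X))).
Proof.
case: X => a1 a2 a3 x1 x2 x3; rewrite /jdet /jcross !jinnerE jmulE /jtr.
rewrite /=.
rewrite !(oconjD, odotZr, odotDr, scalerN, odotNr, odot0r) ?mulr1.
(* The cross product yields one cubic term for each diagonal position; cyclic invariance brings all
   three to Re(x1(x2 x3)). *)
by rewrite (odot_mulC x2 x3 x1) !(odot_mulC x3 x1 x2) /=; field.
Qed.
End Det.

Lemma det_mx33 (R : comNzRingType) (A : 'M[R]_3) : \det A =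
  A 0 0 * (A 1 1 * A 2 2 - A 1 2 * A 2 1)
  - A 0 1 * (A 1 0 * A 2 2 - A 1 2 * A 2 0)
  + A 0 2 * (A 1 0 * A 2 1 - A 1 1 * A 2 0).
Proof.
(* Naming the entries by natural numbers lets the different ordinals produced by nested cofactor
   expansions be identified by computation. *)
pose a (m n : nat) := A (inord m) (inord n).
have Aa i j : A i j = a i j by rewrite /a !inord_val.
rewrite (expand_det_row _ 0) !big_ord_recl big_ord0 /cofactor.
rewrite !(expand_det_row _ 0) !big_ord_recl !big_ord0 /cofactor !det_mx11.
rewrite !mxE !Aa /=.
rewrite /bump /= !addn0 !addn1 !exprS !expr0.
by ring.
Qed.

Lemma sum3E (V : nmodType) (F : 'I_3 -> V) : \sum_i F i = F 0 + F 1 + F 2.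
Proof.
rewrite !big_ord_recr big_ord0 /= add0r.
by congr (F _ + F _ + F _); apply: val_inj.
Qed.

Lemma ord3P (i : 'I_3) : [\/ i = 0, i = 1 | i = 2].
Proof.
by case: i => -[|[|[|m]]] // hm; [constructor 1|constructor 2|constructor 3];
  exact: val_inj.
Qed.

(** * Eigenspace coordinates *)

Section Coord.
Variable C : numClosedFieldType.
Local Notation J := (jordan C).
Local Notation i := ('i : C).

Definition mx3 (a b c d e f g h k : C) : 'M[C]_3 :=
  \matrix_(i, j)
    nth 0 (nth [::] [:: [:: a; b; c]; [:: d; e; f]; [:: g; h; k]] i) j.

(* [zM], [zb] and [zc] are the components of an element of J^C in the
   eigenspaces of w_3 for the eigenvalues 1, omega and omega^2; column j of
   [zb] and of [zc] consists of the components in the eigenspaces of gamma_3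
   for omega^j and omega^(-j). *)
Definition zM (X : J) : 'M[C]_3 :=
  let p (x : oct C) := qc0 x.1 + i * qc1 x.1 in
  let m (x : oct C) := qc0 x.1 - i * qc1 x.1 in
  mx3 (jxi1 X) (m (jx3 X)) (p (jx2 X))
      (p (jx3 X)) (jxi2 X) (m (jx1 X))
      (m (jx2 X)) (p (jx1 X)) (jxi3 X).

Definition zb (X : J) : 'M[C]_3 :=
  \matrix_(k, j)
    let x := nth 0 [:: jx1 X; jx2 X; jx3 X] k in
    nth 0 [:: qc2 x.1 + i * qc3 x.1;
              qc0 x.2 + i * qc1 x.2;
              qc2 x.2 - i * qc3 x.2] j.

Definition zc (X : J) : 'M[C]_3 :=
  \matrix_(k, j)
    let x := nth 0 [:: jx1 X; jx2 X; jx3 X] k in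
    nth 0 [:: qc2 x.1 - i * qc3 x.1;
              qc0 x.2 - i * qc1 x.2;
              qc2 x.2 + i * qc3 x.2] j.

(** Sending e1 to i or to -i gives the two coordinates p = x0 + i x1 and m = x0 - i x1, which [re]
    and [im] invert. The last [im] has its arguments exchanged because column 2 of [zb] carries -i
    where the other columns carry +i. *)
Definition mkJ (M b c : 'M[C]_3) : J :=
  let re p m : C := (p + m) / 2 in
  let im p m : C := i * (m - p) / 2 in
  let x (l r k : 'I_3) : oct C :=
    (Quat (re (M r l) (M l r)) (im (M r l) (M l r))
          (re (b k 0) (c k 0)) (im (b k 0) (c k 0)),
     Quat (re (b k 1) (c k 1)) (im (b k 1) (c k 1))
          (re (b k 2) (c k 2)) (im (c k 2) (b k 2))) in
  Jordan (M 0 0) (M 1 1) (M 2 2) (x 1 2 0) (x 2 0 1) (x 0 1 2).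

Let i2 : i * i = -1. Proof. by rewrite -expr2 sqrCi. Qed.

Lemma mx3_eq (A B : 'M[C]_3) :
  A 0 0 = B 0 0 -> A 0 1 = B 0 1 -> A 0 2 = B 0 2 ->
  A 1 0 = B 1 0 -> A 1 1 = B 1 1 -> A 1 2 = B 1 2 ->
  A 2 0 = B 2 0 -> A 2 1 = B 2 1 -> A 2 2 = B 2 2 -> A = B.
Proof.
by move=> *; apply/matrixP => m n; case: (ord3P m) => ->; case: (ord3P n) => ->.
Qed.

Lemma zM_mkJ M b c : zM (mkJ M b c) = M.
Proof. by apply mx3_eq; rewrite !mxE //=; field: i2. Qed.

Lemma zb_mkJ M b c : zb (mkJ M b c) = b.
Proof. by apply mx3_eq; rewrite !mxE //=; field: i2. Qed.

Lemma zc_mkJ M b c : zc (mkJ M b c) = c.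
Proof. by apply mx3_eq; rewrite !mxE //=; field: i2. Qed.

Lemma mkJK X : mkJ (zM X) (zb X) (zc X) = X.
Proof.
case: X => ? ? ? [[? ? ? ?] [? ? ? ?]] [[? ? ? ?] [? ? ? ?]]
  [[? ? ? ?] [? ? ? ?]].
by congr Jordan; [rewrite mxE|rewrite mxE|rewrite mxE|..] => //;
  congr (Quat _ _ _ _, Quat _ _ _ _); rewrite !mxE /=; field: i2.
Qed.

Lemma zM_linear : linear zM.
Proof. by move=> a X Y; apply mx3_eq; rewrite !mxE //=; ring. Qed.

Lemma zb_linear : linear zb.
Proof. by move=> a X Y; apply mx3_eq; rewrite !mxE //=; ring. Qed.

Lemma zc_linear : linear zc.
Proof. by move=> a X Y; apply mx3_eq; rewrite !mxE //=; ring. Qed.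

HB.instance Definition _ := GRing.isLinear.Build C J 'M[C]_3 _ zM zM_linear.
HB.instance Definition _ := GRing.isLinear.Build C J 'M[C]_3 _ zb zb_linear.
HB.instance Definition _ := GRing.isLinear.Build C J 'M[C]_3 _ zc zc_linear.

(** Invariance under gamma_3 and w_3 allows only cubic monomials whose weights multiply to 1, which
    is why no further mixed terms in M, b, c occur. The coefficients come from a polynomial identity
    in the 27 coordinates. *)
Lemma jdet_coord X : jdet X =
  \det (zM X) - \det (zb X) - \det (zc X) - \tr ((zc X)^T *m zM X *m zb X).
Proof.
rewrite jdetE !det_mx33 /mxtrace sum3E !mxE !sum3E !mxE !sum3E !mxE.
case: X => ? ? ? [[? ? ? ?] [? ? ? ?]] [[? ? ? ?] [? ? ? ?]]
  [[? ? ? ?] [? ? ? ?]].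
by rewrite /odot /=; ring: i2.
Qed.

Local Notation omega := (@omega C).

Let s2 : sqrtC 3 * sqrtC 3 = 3 :> C. Proof. by rewrite -expr2 sqrtCK. Qed.

Lemma jordan_coordP (X Y : J) :
  zM X = zM Y -> zb X = zb Y -> zc X = zc Y -> X = Y.
Proof. by move=> hM hb hc; rewrite -(mkJK X) -(mkJK Y) hM hb hc. Qed.

(** The factor 2 on the off-diagonal part of the inner product is absorbed by |x0 + i x1|^2 + |x0 -
    i x1|^2 = 2 (|x0|^2 + |x1|^2) and its polarisation. Hence isometries act by unitary matrices
    without rescaling. *)
Lemma jherm_coord (X Y : J) : jherm X Y =
  \tr ((zM X)^t* *m zM Y) + \tr ((zb X)^t* *m zb Y) + \tr ((zc X)^t* *m zc Y).
Proof.
rewrite /jherm jinnerE /mxtrace !sum3E !mxE !sum3E !mxE.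
case: X Y => ? ? ? [[? ? ? ?] [? ? ? ?]] [[? ? ? ?] [? ? ? ?]]
  [[? ? ? ?] [? ? ? ?]] [? ? ? [[? ? ? ?] [? ? ? ?]] [[? ? ? ?] [? ? ? ?]]
  [[? ? ? ?] [? ? ? ?]]].
rewrite /odot /= !(rmorphD, rmorphM) /= !rmorphN /= !rmorphM /= !conjCi.
by ring: i2.
Qed.

Lemma zM_w3 (X : J) : zM (w3_map X) = zM X.
Proof. by apply mx3_eq; rewrite !mxE //=; field. Qed.

Lemma zb_w3 (X : J) : zb (w3_map X) = omega *: zb X.
Proof. by apply mx3_eq; rewrite !mxE //= /omega; field: i2. Qed.

Lemma zc_w3 (X : J) : zc (w3_map X) = omega ^+ 2 *: zc X.
Proof. by apply mx3_eq; rewrite !mxE //= /omega; field: i2 s2. Qed.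

Lemma zM_gamma3 (X : J) : zM (gamma3_map X) = zM X.
Proof. by apply mx3_eq; rewrite !mxE //=; field. Qed.

Lemma zb_gamma3 (X : J) k j : zb (gamma3_map X) k j = omega ^+ j * zb X k j.
Proof.
case: X => ? ? ? [[? ? ? ?] [? ? ? ?]] [[? ? ? ?] [? ? ? ?]]
  [[? ? ? ?] [? ? ? ?]].
by case: (ord3P k) => ->; case: (ord3P j) => ->; rewrite !mxE /= /omega;
  field: i2 s2.
Qed.

Lemma zc_gamma3 (X : J) k j : zc (gamma3_map X) k j = omega ^+ (2 * j) * zc X k j.
Proof.
case: X => ? ? ? [[? ? ? ?] [? ? ? ?]] [[? ? ? ?] [? ? ? ?]]
  [[? ? ? ?] [? ? ? ?]].
by case: (ord3P k) => ->; case: (ord3P j) => ->; rewrite !mxE /= /omega;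
  field: i2 s2.
Qed.
End Coord.

(** * The action of U(1) x U(1) x SU(3) x SU(3) *)

Section Act.
Variable C : numClosedFieldType.
Local Notation J := (jordan C).
Local Notation G := (U1 C * U1 C * SU3 C * SU3 C)%type.

(* [(s, t) |-> torus s t] maps U(1) x U(1) onto the diagonal torus of SU(3) with
   kernel {(1, 1), (-1, -1)}, and (1, omega) to the scalar matrix omega. *)
Definition torus (s t : C) : 'rV[C]_3 :=
  \row_j nth 0 [:: s * t; s^-1 * t; t ^- 2] j.

Lemma U1_conj (z : U1 C) : (U1_val z)^* = (U1_val z)^-1.
Proof. by rewrite invC_norm U1_norm expr1n invr1 mul1r. Qed.

Lemma U1_unit (z : U1 C) : U1_val z != 0.
Proof. by rewrite -normr_eq0 U1_norm oner_eq0. Qed.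

Lemma torusM s t s' t' j :
  torus (s * s') (t * t') 0 j = torus s t 0 j * torus s' t' 0 j.
Proof. by case: (ord3P j) => ->; rewrite !mxE /= ?invfM ?exprMn ?invfM; ring. Qed.

Lemma torus_conj (s t : U1 C) j :
  torus (U1_val s) (U1_val t) 0 j * (torus (U1_val s) (U1_val t) 0 j)^* = 1.
Proof.
have := U1_unit s; have := U1_unit t.
by case: (ord3P j) => ->;
  rewrite !mxE /= ?(rmorphM, fmorphV, rmorphXn) /= !U1_conj => ht hs;
  field; rewrite ?hs ?ht.
Qed.

Definition torus_mx (x : G) : 'M[C]_3 :=
  diag_mx (torus (U1_val x.1.1.1) (U1_val x.1.1.2)).

Lemma torus_mx_conj x : (torus_mx x) ^ conjC *m torus_mx x = 1%:M.
Proof.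
rewrite map_diag_mx mulmx_diag -diag_const_mx; congr diag_mx; apply/rowP => j.
by rewrite mxE [LHS]mulrC [in X in _ * X]mxE torus_conj mxE.
Qed.

Lemma torus_mx_conjr x : torus_mx x *m (torus_mx x) ^ conjC = 1%:M.
Proof. by apply: mulmx1C; exact: torus_mx_conj. Qed.

Lemma tr_torus_mx x : (torus_mx x)^T = torus_mx x.
Proof. exact: tr_diag_mx. Qed.

Lemma det_torus_mx x : \det (torus_mx x) = 1.
Proof.
case: x => [[[s t] A] B]; have := U1_unit s; have := U1_unit t.
rewrite det_diag !big_ord_recr big_ord0 /= !mxE /= => ht hs.
by field; rewrite ht hs.
Qed.

Lemma torus_mxM (x y : G) : torus_mx (x * y)%g = torus_mx x *m torus_mx y.
Proof.
rewrite mulmx_diag; congr diag_mx; apply/rowP => j.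
by rewrite [RHS]mxE -torusM.
Qed.

Lemma torus_mxC (x y : G) : torus_mx x *m torus_mx y = torus_mx y *m torus_mx x.
Proof. exact: diag_mxC. Qed.

Lemma torus_mx1 : torus_mx 1%g = 1%:M.
Proof.
rewrite -diag_const_mx; congr diag_mx; apply/rowP => j.
by case: (ord3P j) => ->; rewrite !mxE /= ?expr1n ?invr1 ?mul1r.
Qed.

Definition act (x : G) (X : J) : J :=
  mkJ ((x.2 : 'M_3) ^ conjC *m zM X *m (x.1.2 : 'M_3)^t*)
      ((x.1.2 : 'M_3) *m zb X *m torus_mx x)
      ((x.2 : 'M_3) *m zc X *m (torus_mx x) ^ conjC).

Lemma zM_act x X :
  zM (act x X) = (x.2 : 'M_3) ^ conjC *m zM X *m (x.1.2 : 'M_3)^t*.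
Proof. exact: zM_mkJ. Qed.

Lemma zb_act x X : zb (act x X) = (x.1.2 : 'M_3) *m zb X *m torus_mx x.
Proof. exact: zb_mkJ. Qed.

Lemma zc_act x X :
  zc (act x X) = (x.2 : 'M_3) *m zc X *m (torus_mx x) ^ conjC.
Proof. exact: zc_mkJ. Qed.

Lemma act_linear x : linear (act x).
Proof.
by move=> a X Y; apply: jordan_coordP;
  rewrite [RHS]linearP !(zM_act, zb_act, zc_act) [in LHS]linearP /=;
  rewrite mulmxDr mulmxDl -scalemxAr -scalemxAl ?(zM_act, zb_act, zc_act).
Qed.

HB.instance Definition _ x := GRing.isLinear.Build C J J _ (act x) (@act_linear x).

Lemma actM (x y : G) X : act (x * y)%g X = act x (act y X).
Proof.
apply: jordan_coordP.
- by rewrite !zM_act /= map_mxM trmx_mul map_mxM /= !mulmxA.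
- by rewrite !zb_act torus_mxM torus_mxC /= !mulmxA.
- by rewrite !zc_act torus_mxM torus_mxC map_mxM /= !mulmxA.
Qed.

Lemma act1 X : act 1%g X = X.
Proof.
apply: jordan_coordP.
- by rewrite !zM_act /= trmx1 !map_mx1 mul1mx mulmx1.
- by rewrite !zb_act torus_mx1 mul1mx mulmx1.
- by rewrite !zc_act torus_mx1 map_mx1 mul1mx mulmx1.
Qed.

Lemma SU3_tcmul (A : SU3 C) : (A : 'M_3)^t* *m A = 1%:M.
Proof. by apply: mulmx1C; apply/unitarymxP/SU3_unitary. Qed.

(** All factors have determinant 1, which settles the three cubes. In the trace, B^T meets conj(B),
    A^* meets A, and the two torus factors meet after a cyclic permutation. *)
Lemma act_det x X : jdet (act x X) = jdet X.
Proof.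
rewrite !jdet_coord zM_act zb_act zc_act !det_mulmx !det_map_mx det_tr SU3_det.
rewrite SU3_det det_torus_mx rmorph1 !mul1r !mulr1; congr (_ - _).
set A := (x.1.2 : 'M_3); set B := (x.2 : 'M_3); set D := torus_mx x.
have hD : (D ^ conjC)^T = D ^ conjC by rewrite map_trmx tr_torus_mx.
rewrite trmx_mul trmx_mul hD.
have hA : A^t* *m A = 1%:M by exact: SU3_tcmul.
have hB : B^T *m B ^ conjC = 1%:M.
  by rewrite -[B^T]map_mxCK -map_mxM SU3_tcmul map_mx1.
rewrite !mulmxA -(mulmxA _ (B^T)) hB mulmx1 -(mulmxA _ (A^t*)) hA mulmx1.
by rewrite mxtrace_mulC !mulmxA torus_mx_conjr mul1mx.
Qed.

Lemma mxtrace_unitary n (U V : 'M[C]_n) (M N : 'M[C]_n) :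
  U \is unitarymx -> V \is unitarymx ->
  \tr ((U *m M *m V)^t* *m (U *m N *m V)) = \tr (M^t* *m N).
Proof.
move=> /unitarymxP/mulmx1C hU /unitarymxP hV.
rewrite !trmx_mul !map_mxM !mulmxA -(mulmxA _ _ U) hU mulmx1.
by rewrite mxtrace_mulC !mulmxA hV mul1mx.
Qed.

Lemma act_herm x X Y : jherm (act x X) (act x Y) = jherm X Y.
Proof.
have hA := SU3_unitary x.1.2; have hB := SU3_unitary x.2.
have hD : torus_mx x \is unitarymx.
  by apply/unitarymxP; rewrite tr_torus_mx torus_mx_conjr.
rewrite !jherm_coord !zM_act !zb_act !zc_act.
by rewrite !mxtrace_unitary ?conjC_unitary ?trmx_unitary.
Qed.

Lemma act_w3 x X : act x (w3_map X) = w3_map (act x X).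
Proof.
apply: jordan_coordP.
- by rewrite zM_w3 !zM_act zM_w3.
- by rewrite zb_w3 !zb_act zb_w3 -scalemxAr -scalemxAl.
- by rewrite zc_w3 !zc_act zc_w3 -scalemxAr -scalemxAl.
Qed.

Lemma act_gamma3 x X : act x (gamma3_map X) = gamma3_map (act x X).
Proof.
apply: jordan_coordP.
- by rewrite zM_gamma3 !zM_act zM_gamma3.
(* On [zb] and [zc] the map gamma_3 scales columns, so it commutes with left multiplication and with
   a diagonal factor on the right. *)
- apply/matrixP => k j; rewrite zb_gamma3 !zb_act mul_mx_diag [LHS]mxE.
  rewrite [in RHS]mul_mx_diag [in RHS]mxE mulrA !mxE mulr_sumr.
  by congr (_ * _); apply: eq_bigr => l _; rewrite zb_gamma3 mulrCA.
- apply/matrixP => k j; rewrite zc_gamma3 !zc_act map_diag_mx mul_mx_diag.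
  rewrite [LHS]mxE [in RHS]mul_mx_diag [in RHS]mxE mulrA !mxE mulr_sumr.
  by congr (_ * _); apply: eq_bigr => l _; rewrite zc_gamma3 mulrCA.
Qed.

Fact act_ker x : lker (linfun (act x)) == 0%VS.
Proof.
apply/lker0P; apply: (can_inj (g := act x^-1%g)) => X.
by rewrite lfunE -actM mulVg act1.
Qed.

Fact act_in_E6 x : LIso (act_ker x) \in @in_E6 C.
Proof.
by apply/in_E6P; split=> [X|X Y]; rewrite !lfunE;
  [exact: act_det|exact: act_herm].
Qed.

Lemma E6P (a b : E6 C) : (forall X, a X = b X) -> a = b.
Proof. by move=> h; do 2!apply: val_inj; apply/lfunP. Qed.

Lemma E6M (a b : E6 C) X : (a * b)%g X = a (b X).
Proof. exact: comp_lfunE. Qed.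

Lemma E6_fixP (g a : E6 C) :
  reflect (forall X, a (g X) = g (a X)) (a \in E6_fix g).
Proof.
rewrite unfold_in -(inj_eq (mulgI g)) !mulgA mulgV mul1g.
apply: (iffP eqP) => [h X|h]; first by rewrite -!E6M h.
by apply: E6P => X; rewrite !E6M h.
Qed.

Lemma gamma3E X : gamma3 C X = gamma3_map X. Proof. exact: lfunE. Qed.

Lemma w3E X : w3 C X = w3_map X. Proof. exact: lfunE. Qed.

Fact act_fix x : E6Make (act_in_E6 x) \in @in_E6_gamma3_w3 C.
Proof.
rewrite inE; apply/andP; split; apply/E6_fixP => X;
  rewrite ?gamma3E ?w3E /= !lfunE /=.
  exact: act_gamma3.
exact: act_w3.
Qed.

Definition phi (x : G) : E6_gamma3_w3 C := E6gwMake (act_fix x).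

Lemma phiE x X : phi x X = act x X. Proof. exact: lfunE. Qed.

Lemma E6gwP (a b : E6_gamma3_w3 C) : (forall X, a X = b X) -> a = b.
Proof. by move=> h; apply: val_inj; apply: E6P. Qed.

Lemma phiM x y : phi (x * y)%g = (phi x * phi y)%g.
Proof. by apply: E6gwP => X; rewrite E6M !phiE actM. Qed.
End Act.

(** * Elements of E_6 commuting with gamma_3 and w_3 *)

Lemma bilinear_ext (R : pzRingType) m n (M N : 'M[R]_(m, n)) :
  (forall (u : 'rV_m) (v : 'cV_n), u *m M *m v = u *m N *m v) -> M = N.
Proof.
move=> h; apply/matrixP => k l; have := h (delta_mx 0 k) (delta_mx l 0).
by rewrite -!rowE -!colE => /matrixP/(_ 0 0); rewrite !mxE.
Qed.

Lemma linear_cV (R : comNzRingType) m n (f : 'cV[R]_n -> 'cV[R]_m) :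
  linear f -> exists A, forall v, f v = A *m v.
Proof.
move=> fL.
pose g : {linear _ -> _} := HB.pack f (GRing.isLinear.Build _ _ _ _ f fL).
exists (\matrix_(k, l) f (delta_mx l 0) k 0) => v.
rewrite {1}[v]matrix_sum_delta -[f]/(g : _ -> _) linear_sum.
apply/matrixP => k l; rewrite ord1 summxE mxE.
by apply: eq_bigr => j _; rewrite big_ord1 linearZ /= !mxE mulrC.
Qed.

(** Commutation with the matrix unit [delta_mx l 0], read in column 0, says that [Q k l] is [Q 0 0]
    if k = l and 0 otherwise. *)
Lemma commuting_scalar (R : comNzRingType) n (Q : 'M[R]_n.+1) :
  (forall M, Q *m M = M *m Q) -> Q = (Q 0 0)%:M.
Proof.
move=> h; apply/matrixP => k l.
have /matrixP/(_ k 0) := h (delta_mx l 0).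
rewrite !mxE (bigD1 l) //= big1 ?addr0 => [|j jl]; last first.
  by rewrite mxE (negPf jl) /= mulr0.
rewrite (bigD1 0) //= big1 ?addr0 => [|j jl]; last first.
  by rewrite mxE (negPf jl) andbF /= mul0r.
by rewrite !mxE !eqxx !andbT mulr1 => ->; rewrite mulr_natl.
Qed.

Section Eigen.
Variable C : numClosedFieldType.
Local Notation J := (jordan C).
Local Notation omega := (@omega C).

Lemma omega_expr3 : omega ^+ 3 = 1.
Proof. by have /andP[_ /eqP] := @omega_SU3 C; rewrite det_scalar. Qed.

Lemma omega_neq1 : omega != 1.
Proof.
apply/eqP => w1; have e : sqrtC 3 * 'i = 2 * omega + 1 :> C.
  by rewrite /Defs.omega; field.
(* Squaring would turn omega = 1 into -3 = 9. *)
have /eqP := congr1 (fun z => z ^+ 2) e.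
rewrite w1 exprMn sqrtCK sqrCi -subr_eq0.
rewrite (_ : _ - _ = - 12%:R); last by ring.
by rewrite oppr_eq0 pnatr_eq0.
Qed.

Lemma omega_prim : 3.-primitive_root omega.
Proof.
have [m pm] := prim_order_exists (isT : 0 < 3)%N omega_expr3.
case/primeP: (isT : prime 3) => _ /[apply] /orP[]/eqP mE; subst m => //.
by have := prim_expr_order pm; rewrite expr1 => /eqP; rewrite (negPf omega_neq1).
Qed.

Lemma omega_eigenval m n (z : C) :
  omega ^+ m * z = omega ^+ n * z -> m != n %[mod 3] -> z = 0.
Proof.
move=> /eqP; rewrite -subr_eq0 -mulrBl mulf_eq0 subr_eq0.
rewrite (eq_prim_root_expr omega_prim).
by case/orP=> [->|/eqP].
Qed.

(** The exponents matter only modulo 3. The pairs that occur are (0, 0), (1, j) and (2, 2j), where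
    2j stands for -j; these are seven distinct weights. *)
Definition joint_eigen p q (X : J) :=
  w3_map X = omega ^+ p *: X /\ gamma3_map X = omega ^+ q *: X.

Lemma joint_eigen_zM p q X : joint_eigen p q X -> p != 0 %[mod 3] -> zM X = 0.
Proof.
case=> hw _ hp; apply/matrixP => k j; rewrite [RHS]mxE.
apply: (@omega_eigenval p 0) => //; rewrite expr0 mul1r.
by have /matrixP/(_ k j) := zM_w3 X; rewrite hw linearZ mxE.
Qed.

Lemma joint_eigen_zb p q X : joint_eigen p q X -> forall k j : 'I_3,
  (p != 1 %[mod 3]) || (q != j %[mod 3]) -> zb X k j = 0.
Proof.
case=> hw hg k j /orP[]; apply: omega_eigenval.
  by have /matrixP/(_ k j) := zb_w3 X; rewrite hw linearZ !mxE.
by have := zb_gamma3 X k j; rewrite hg linearZ !mxE.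
Qed.

Lemma joint_eigen_zc p q X : joint_eigen p q X -> forall k j : 'I_3,
  (p != 2 %[mod 3]) || (q != 2 * j %[mod 3]) -> zc X k j = 0.
Proof.
case=> hw hg k j /orP[]; apply: omega_eigenval.
  by have /matrixP/(_ k j) := zc_w3 X; rewrite hw linearZ !mxE.
by have := zc_gamma3 X k j; rewrite hg linearZ !mxE.
Qed.

Definition embM (M : 'M[C]_3) : J := mkJ M 0 0.
(** The matrix [v *m delta_mx 0 j] has v as column j and zeros elsewhere. *)
Definition embb j (v : 'cV[C]_3) : J := mkJ 0 (v *m delta_mx 0 j) 0.
Definition embc j (v : 'cV[C]_3) : J := mkJ 0 0 (v *m delta_mx 0 j).

Lemma mul_delta_tr (j : 'I_3) :
  (delta_mx 0 j : 'rV[C]_3) *m (delta_mx 0 j)^T = 1%:M.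
Proof.
rewrite trmx_delta mul_delta_mx.
by apply/matrixP => k l; rewrite !ord1 !mxE.
Qed.

Lemma mxtrace_cV_delta (j : 'I_3) (u v : 'cV[C]_3) :
  \tr ((u *m (delta_mx 0 j : 'rV_3))^t* *m (v *m (delta_mx 0 j : 'rV_3)))
  = \tr (u^t* *m v).
Proof.
rewrite trmx_mul map_mxM !mulmxA mxtrace_mulC !mulmxA.
have -> : ((delta_mx 0 j : 'rV[C]_3)^t* : 'cV_3) = (delta_mx 0 j)^T.
  by rewrite trmx_delta map_delta_mx.
by rewrite mul_delta_tr mul1mx.
Qed.

Lemma mul_cV_delta (v : 'cV[C]_3) (j k l : 'I_3) :
  (v *m (delta_mx 0 j : 'rV_3)) k l = v k 0 * (l == j)%:R.
Proof. by rewrite mxE big_ord1 mxE. Qed.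

Lemma joint_eigen_embM M : joint_eigen 0 0 (embM M).
Proof.
split; rewrite expr0 scale1r; apply: jordan_coordP.
- by rewrite zM_w3.
- by rewrite zb_w3 zb_mkJ scaler0.
- by rewrite zc_w3 zc_mkJ scaler0.
- by rewrite zM_gamma3.
- by apply/matrixP => k j; rewrite zb_gamma3 zb_mkJ !mxE mulr0.
- by apply/matrixP => k j; rewrite zc_gamma3 zc_mkJ !mxE mulr0.
Qed.

Lemma joint_eigen_embb (j : 'I_3) v : joint_eigen 1 j (embb j v).
Proof.
split; apply: jordan_coordP; rewrite linearZ /=.
- by rewrite zM_w3 zM_mkJ scaler0.
- by rewrite zb_w3 zb_mkJ.
- by rewrite zc_w3 zc_mkJ !scaler0.
- by rewrite zM_gamma3 zM_mkJ scaler0.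
- apply/matrixP => k l; rewrite zb_gamma3 zb_mkJ [RHS]mxE mul_cV_delta.
  by case: eqP => [->|_]; rewrite // !mulr0.
- by apply/matrixP => k l; rewrite zc_gamma3 zc_mkJ !mxE !mulr0.
Qed.

Lemma joint_eigen_embc (j : 'I_3) v : joint_eigen 2 (2 * j) (embc j v).
Proof.
split; apply: jordan_coordP; rewrite linearZ /=.
- by rewrite zM_w3 zM_mkJ scaler0.
- by rewrite zb_w3 zb_mkJ !scaler0.
- by rewrite zc_w3 zc_mkJ.
- by rewrite zM_gamma3 zM_mkJ scaler0.
- by apply/matrixP => k l; rewrite zb_gamma3 zb_mkJ !mxE !mulr0.
- apply/matrixP => k l; rewrite zc_gamma3 zc_mkJ [RHS]mxE mul_cV_delta.
  by case: eqP => [->|_]; rewrite // !mulr0.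
Qed.

Lemma embb_linear j : linear (embb j).
Proof.
move=> a u v; apply: jordan_coordP;
  rewrite linearP /= !(zM_mkJ, zb_mkJ, zc_mkJ) ?scaler0 ?addr0 //.
by rewrite mulmxDl -scalemxAl.
Qed.

Lemma embc_linear j : linear (embc j).
Proof.
move=> a u v; apply: jordan_coordP;
  rewrite linearP /= !(zM_mkJ, zb_mkJ, zc_mkJ) ?scaler0 ?addr0 //.
by rewrite mulmxDl -scalemxAl.
Qed.

HB.instance Definition _ j := GRing.isLinear.Build C _ J _ (embb j) (@embb_linear j).
HB.instance Definition _ j := GRing.isLinear.Build C _ J _ (embc j) (@embc_linear j).

(** This is the decomposition into joint eigenvectors; it reduces a linear map to its values on the
    seven eigenspaces. *)
Lemma mkJ_sum M b c :
  mkJ M b c = embM M + \sum_j embb j (col j b) + \sum_j embc j (col j c).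
Proof.
have colsum (N : 'M[C]_3) : N = \sum_j col j N *m (delta_mx 0 j : 'rV_3).
  apply/matrixP => k l; rewrite summxE (bigD1 l) //= mul_cV_delta eqxx mulr1 mxE.
  by rewrite big1 ?addr0 // => j /negPf jl; rewrite mul_cV_delta eq_sym jl mulr0.
apply: jordan_coordP; rewrite !linearD !linear_sum /=.
- by rewrite !zM_mkJ !big1 ?addr0 // => j _; rewrite zM_mkJ.
- rewrite !zb_mkJ add0r [X in _ + X]big1 ?addr0 => [|j _]; last by rewrite zb_mkJ.
  by rewrite {1}[b]colsum; apply: eq_bigr => j _; rewrite zb_mkJ.
- rewrite !zc_mkJ add0r [X in X + _]big1 ?add0r => [|j _]; last by rewrite zc_mkJ.
  by rewrite {1}[c]colsum; apply: eq_bigr => j _; rewrite zc_mkJ.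
Qed.

(** With a single nonzero column in b and in c their determinants vanish, so the pairing of the
    eigenspaces number j through M is isolated. *)
Lemma jdet_rank1 M j u v :
  jdet (embM M + embb j v + embc j u) = \det M - \tr (u^T *m M *m v).
Proof.
have det0 (w : 'cV[C]_3) : \det (w *m (delta_mx 0 j : 'rV_3)) = 0.
  by rewrite det_mx33 !mul_cV_delta; ring.
rewrite jdet_coord !linearD /= !(zM_mkJ, zb_mkJ, zc_mkJ) !addr0 !add0r !det0 !subr0.
congr (_ - _); rewrite trmx_mul !trmx0 !mulmx0 !mxtrace0 !addr0 !add0r mulmxA.
by rewrite mxtrace_mulC !mulmxA mul_delta_tr mul1mx.
Qed.

Lemma jherm_embb j u v : jherm (embb j u) (embb j v) = \tr (u^t* *m v).
Proof.
rewrite jherm_coord !(zM_mkJ, zb_mkJ, zc_mkJ) !mulmx0 !mxtrace0 add0r addr0.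
exact: mxtrace_cV_delta.
Qed.

Lemma jherm_embc j u v : jherm (embc j u) (embc j v) = \tr (u^t* *m v).
Proof.
rewrite jherm_coord !(zM_mkJ, zb_mkJ, zc_mkJ) !mulmx0 !mxtrace0 !add0r.
exact: mxtrace_cV_delta.
Qed.
End Eigen.

(** * Block form of the elements of the centralizer, and surjectivity of [phi] *)

Section Surj.
Variable C : numClosedFieldType.
Local Notation J := (jordan C).
Local Notation omega := (@omega C).
Local Notation G := (U1 C * U1 C * SU3 C * SU3 C)%type.
Implicit Types (a : E6_gamma3_w3 C) (X : J).

Lemma E6gw_gamma3 a X : a (gamma3_map X) = gamma3_map (a X).
Proof.
by have := valP a; rewrite inE => /andP[/E6_fixP/(_ X) + _]; rewrite !gamma3E.
Qed.

Lemma E6gw_w3 a X : a (w3_map X) = w3_map (a X).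
Proof.
by have := valP a; rewrite inE => /andP[_ /E6_fixP/(_ X)]; rewrite !w3E.
Qed.

Lemma E6gw_det a X : jdet (a X) = jdet X.
Proof. by have /in_E6P[] := valP (val a). Qed.

Lemma E6gw_herm a X Y : jherm (a X) (a Y) = jherm X Y.
Proof. by have /in_E6P[] := valP (val a). Qed.

Lemma E6gw_joint_eigen a p q X : joint_eigen p q X -> joint_eigen p q (a X).
Proof. by case=> hw hg; split; rewrite -?E6gw_w3 -?E6gw_gamma3 ?hw ?hg linearZ. Qed.

Lemma isometry_unitary (U : 'M[C]_3) :
  (forall u v : 'cV_3, \tr ((U *m u)^t* *m (U *m v)) = \tr (u^t* *m v)) ->
  U \is unitarymx.
Proof.
move=> h; apply/unitarymxP/mulmx1C/bilinear_ext => u v.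
have := h (u^t*) v; rewrite trmx_mul map_mxM trmxCK mulmx1 !mulmxA => e.
apply/matrixP => k l; rewrite !ord1.
by move: e; rewrite /mxtrace !big_ord1.
Qed.

Lemma E6gw_embb a (j : 'I_3) :
  exists2 U : 'M[C]_3, U \is unitarymx & forall v, a (embb j v) = embb j (U *m v).
Proof.
have [|U hU] := @linear_cV _ _ _ (fun v => col j (zb (a (embb j v)))).
  by move=> r u v; rewrite !linearP.
have aU v : a (embb j v) = embb j (U *m v).
  (* The image has the same weights as [embb j v], so every coordinate except column j of [zb]
     vanishes. *)
  have e := E6gw_joint_eigen a (joint_eigen_embb j v); rewrite -hU.
  apply: jordan_coordP; rewrite ?(zM_mkJ, zb_mkJ, zc_mkJ).
  - exact: joint_eigen_zM e _.
  - apply/matrixP => k l; rewrite mul_cV_delta.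
    case: (eqVneq l j) => [->|lj]; first by rewrite [in RHS]mxE mulr1.
    by rewrite mulr0 (joint_eigen_zb e) //= !modn_small // eq_sym.
  - by apply/matrixP => k l; rewrite (joint_eigen_zc e) ?mxE.
exists U => //; apply: isometry_unitary => u v.
by rewrite -(jherm_embb j) -!aU E6gw_herm jherm_embb.
Qed.

Lemma E6gw_embc a (j : 'I_3) :
  exists2 V : 'M[C]_3, V \is unitarymx & forall v, a (embc j v) = embc j (V *m v).
Proof.
have [|U hU] := @linear_cV _ _ _ (fun v => col j (zc (a (embc j v)))).
  by move=> r u v; rewrite !linearP.
have aU v : a (embc j v) = embc j (U *m v).
  have e := E6gw_joint_eigen a (joint_eigen_embc j v); rewrite -hU.
  apply: jordan_coordP; rewrite ?(zM_mkJ, zb_mkJ, zc_mkJ).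
  - exact: joint_eigen_zM e _.
  - by apply/matrixP => k l; rewrite (joint_eigen_zb e) ?mxE.
  - apply/matrixP => k l; rewrite mul_cV_delta.
    case: (eqVneq l j) => [->|lj]; first by rewrite [in RHS]mxE mulr1.
    rewrite mulr0 (joint_eigen_zc e) //=.
    (* Doubling is injective modulo 3; the cases are checked one by one. *)
    by move: lj; case: (ord3P l) => ->; case: (ord3P j) => ->.
exists U => //; apply: isometry_unitary => u v.
by rewrite -(jherm_embc j) -!aU E6gw_herm jherm_embc.
Qed.

Lemma E6gw_embM a M : a (embM M) = embM (zM (a (embM M))).
Proof.
have e := E6gw_joint_eigen a (joint_eigen_embM M).
apply: jordan_coordP; rewrite ?(zM_mkJ, zb_mkJ, zc_mkJ) //.
- by apply/matrixP => k l; rewrite (joint_eigen_zb e) ?mxE.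
- by apply/matrixP => k l; rewrite (joint_eigen_zc e) ?mxE.
Qed.

Lemma E6gw_zM a (j : 'I_3) (U V : 'M[C]_3) :
  U \is unitarymx -> V \is unitarymx ->
  (forall v, a (embb j v) = embb j (U *m v)) ->
  (forall v, a (embc j v) = embc j (V *m v)) ->
  forall M, a (embM M) = embM (V ^ conjC *m M *m U^t*).
Proof.
move=> uU uV hU hV M; rewrite E6gw_embM; congr embM; set N := zM _.
have detE (u v : 'cV_3) :
    \det N - \tr ((V *m u)^T *m N *m (U *m v)) = \det M - \tr (u^T *m M *m v).
  rewrite -(jdet_rank1 N j (V *m u)) -(jdet_rank1 M j u) -hU -hV -E6gw_embM.
  by rewrite -!linearD; exact: E6gw_det.
(* Taking u = v = 0 separates the cubic part, and what remains is invariance of the pairing of u and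
   v through the matrix. *)
have detNM : \det N = \det M.
  by have := detE 0 0; rewrite !mulmx0 !mxtrace0 !subr0.
(* This is the matrix form of that invariance; unitarity of U and V solves it for N. *)
suff -> : M = V^T *m N *m U.
  have /unitarymxP U1 := uU; have /unitarymxP V1 := uV.
  rewrite !mulmxA -(mulmxA _ U) U1 mulmx1.
  by rewrite -[V^T]map_mxCK -map_mxM V1 map_mx1 mul1mx.
apply: bilinear_ext => u v; have := detE u^T v.
rewrite detNM => /addrI/oppr_inj; rewrite trmx_mul trmxK !mulmxA => e.
apply/matrixP => k l; rewrite !ord1.
by move: e; rewrite /mxtrace !big_ord1.
Qed.

Lemma conj_unitarymx (A : 'M[C]_3) :
  A \is unitarymx -> A^T *m A ^ conjC = 1%:M.
Proof.
by move=> /unitarymxP/mulmx1C hA; rewrite -[A^T]map_mxCK -map_mxM hA map_mx1.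
Qed.

(** The shape of [act] before normalisation: [act] is the case where A and B lie in SU(3) and m is
    the row given by [torus]. *)
Definition block_action (A B : 'M[C]_3) (m : 'rV[C]_3) X :=
  mkJ (B ^ conjC *m zM X *m A^t*) (A *m zb X *m diag_mx m)
      (B *m zc X *m diag_mx (m ^ conjC)).

Lemma col_mul_diag (A b : 'M[C]_3) (m : 'rV[C]_3) j :
  col j (A *m b *m diag_mx m) = m 0 j *: (A *m col j b).
Proof.
rewrite [col j b]colE mulmxA -colE.
by apply/matrixP => k l; rewrite mul_mx_diag !mxE mulrC.
Qed.

Lemma E6gw_block_action a : exists (A B : 'M[C]_3) (m : 'rV[C]_3),
  [/\ A \is unitarymx, B \is unitarymx, forall j, m 0 j * (m 0 j)^* = 1 &
      forall X, a X = block_action A B m X].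
Proof.
have [U uU hU] := fin_all_exists2 (E6gw_embb a).
have [V uV hV] := fin_all_exists2 (E6gw_embc a).
have hM j := E6gw_zM (uU j) (uV j) (hU j) (hV j).
(* The action on M is expressed through (U_j, V_j) for every j. Equating it with the case 0 gives
   P_j M = M Q_j for all M; M = E yields P_j = Q_j, and then Q_j commutes with every matrix, hence
   is a scalar m_j. *)
pose P j := (V 0)^T *m (V j) ^ conjC; pose Q j := (U 0)^t* *m U j.
have tU j : U j *m (U j)^t* = 1%:M by apply/unitarymxP.
have tV j : V j *m (V j)^t* = 1%:M by apply/unitarymxP.
have tcU j : (U j)^t* *m U j = 1%:M by apply/mulmx1C/unitarymxP.
have PQ j M : P j *m M = M *m Q j.
  have e : (V j) ^ conjC *m M *m (U j)^t* = (V 0) ^ conjC *m M *m (U 0)^t*.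
    by have := congr1 (@zM C) (etrans (esym (hM j M)) (hM 0 M)); rewrite !zM_mkJ.
  rewrite /P -mulmxA -[_ *m M]mulmx1 -(tcU j) (mulmxA _ _ (U j)) e !mulmxA.
  by rewrite conj_unitarymx // mul1mx.
have PQ1 j : P j = Q j by rewrite -[P j]mulmx1 PQ mul1mx.
have Qs j : Q j = (Q j 0 0)%:M.
  by apply: commuting_scalar => M; rewrite -PQ1 PQ PQ1.
pose m : 'rV[C]_3 := \row_j Q j 0 0.
have mE j : m 0 j = Q j 0 0 by rewrite [LHS]mxE.
have UE j : U j = m 0 j *: U 0.
  rewrite -[LHS]mul1mx -(tU 0) -mulmxA -/(Q j) Qs.
  by rewrite mul_mx_scalar mE.
have VE j : V j = (m 0 j)^* *: V 0.
  have -> : V j = V 0 *m (P j) ^ conjC.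
    by rewrite /P map_mxM map_mxCK mulmxA tV mul1mx.
  by rewrite PQ1 Qs map_scalar_mx mul_mx_scalar mE.
have m1 j : m 0 j * (m 0 j)^* = 1.
  have := tU j; rewrite UE linearZ /= map_mxZ -scalemxAl -scalemxAr tU scalerA.
  by move/matrixP/(_ 0 0); rewrite !mxE mulr1.
exists (U 0), (V 0), m; split=> // X.
rewrite -[X in LHS]mkJK /block_action !mkJ_sum !linearD !linear_sum /= (hM 0).
congr (_ + _ + _); apply: eq_bigr => j _.
  by rewrite hU UE -scalemxAl col_mul_diag.
by rewrite hV VE -scalemxAl col_mul_diag [in RHS]mxE.
Qed.

Lemma jdet_mkJ0 (b c : 'M[C]_3) : jdet (mkJ 0 b c) = - \det b - \det c.
Proof.
rewrite jdet_coord zM_mkJ zb_mkJ zc_mkJ mulmx0 mul0mx mxtrace0 subr0.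
by rewrite det0 sub0r.
Qed.

Lemma block_action_mkJ0 A B m b c : block_action A B m (mkJ 0 b c) =
  mkJ 0 (A *m b *m diag_mx m) (B *m c *m diag_mx (m ^ conjC)).
Proof. by rewrite /block_action zM_mkJ zb_mkJ zc_mkJ mulmx0 mul0mx. Qed.

Lemma U1_of (z : C) : z * z^* = 1 -> exists u : U1 C, U1_val u = z.
Proof.
rewrite -normCK => hz; have hz1 : `|z| == 1 by rewrite -(@pexpr_eq1 _ _ 2) // hz.
by exists (U1Make hz1).
Qed.

Lemma SU3_of (A : 'M[C]_3) :
  A \is unitarymx -> \det A = 1 -> exists U : SU3 C, U = A :> 'M_3.
Proof.
move=> h d; have hA : (A \is unitarymx) && (\det A == 1) by rewrite h d eqxx.
by exists (SU3Make hA).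
Qed.

Lemma mulJ1_neq0 (z : C) : z * z^* = 1 -> z != 0.
Proof. by apply: contra_eq_neq => ->; rewrite mul0r eq_sym oner_neq0. Qed.

Lemma mulJ1_conj (z : C) : z * z^* = 1 -> z^* = z^-1.
Proof.
by move=> z1; have z0 := mulJ1_neq0 z1; apply: (mulfI z0); rewrite z1 mulfV.
Qed.

Lemma scale_unitarymx (z : C) (A : 'M[C]_3) :
  z * z^* = 1 -> A \is unitarymx -> z *: A \is unitarymx.
Proof.
move=> hz /unitarymxP hA; apply/unitarymxP.
by rewrite linearZ /= map_mxZ -scalemxAl -scalemxAr hA scalerA hz scale1r.
Qed.

(** This keeps in U(1) the cube root and the square root chosen in the proof of surjectivity. *)
Lemma expr_mulJ1 n (z d : C) :
  (0 < n)%N -> z ^+ n = d -> d * d^* = 1 -> z * z^* = 1.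
Proof.
move=> n0 <-; rewrite -!normCK normrX -exprM mulnC exprM => h.
by apply/eqP; rewrite -(@pexpr_eq1 _ _ n) ?exprn_ge0 //; apply/eqP.
Qed.

Lemma det_unitary (A : 'M[C]_3) :
  A \is unitarymx -> \det A * (\det A)^* = 1.
Proof.
move=> /unitarymxP/(congr1 determinant).
by rewrite det_mulmx det_map_mx det_tr det1.
Qed.

Lemma prod3E (R : comPzSemiRingType) (F : 'I_3 -> R) :
  \prod_i F i = F 0 * F 1 * F 2.
Proof.
rewrite !big_ord_recr big_ord0 /= mul1r.
by congr (F _ * F _ * F _); apply: val_inj.
Qed.

Lemma phi_surj a : exists x, phi x = a.
Proof.
have [A [B [m [uA uB m1 aE]]]] := E6gw_block_action a.
set d := \prod_j m 0 j.
(* Testing the determinant where only b, and next only c, is nonzero and equal to E fixes det A and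
   det B in terms of the product of the phases. *)
have dA : \det A * d = 1.
  have := E6gw_det a (mkJ 0 1%:M 0); rewrite aE block_action_mkJ0 !jdet_mkJ0.
  by rewrite !det_mulmx det0 det1 det_diag mulr0 mul0r mulr1 !subr0 => /oppr_inj.
have dB : \det B * d^* = 1.
  have -> : d^* = \prod_j (m ^ conjC) 0 j.
    by rewrite rmorph_prod; apply: eq_bigr => j _; rewrite mxE.
  have := E6gw_det a (mkJ 0 0 1%:M); rewrite aE block_action_mkJ0 !jdet_mkJ0.
  rewrite !det_mulmx det0 det1 !det_diag mulr0 mul0r mulr1 !oppr0 !sub0r.
  exact: oppr_inj.
(* Replacing (A, B, m) by (z^-1 A, z B, z m) leaves the action unchanged since |z| = 1, and with z^3
   = det A both matrices acquire determinant 1. Another choice of cube root would multiply z by a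
   power of omega. *)
pose z := 3.-root (\det A).
have z3 : z ^+ 3 = \det A by rewrite rootCK.
have dA1 := det_unitary uA; have z1 : z * z^* = 1 by apply: expr_mulJ1 z3 dA1.
have z0 := mulJ1_neq0 z1; have zJ := mulJ1_conj z1.
have zV1 : z^-1 * z^-1^* = 1 by rewrite -zJ conjCK mulrC.
have [A' A'E] : exists U : SU3 C, U = z^-1 *: A :> 'M_3.
  apply: SU3_of; rewrite ?scale_unitarymx // detZ exprVn z3 mulVf //.
  by rewrite -z3 expf_neq0.
have dd : d * d^* = 1.
  by rewrite rmorph_prod -big_split big1 //= => j _; exact: m1.
have [B' B'E] : exists U : SU3 C, U = z *: B :> 'M_3.
  apply: SU3_of; rewrite ?scale_unitarymx // detZ z3.
  have -> : \det A = d^* by rewrite -[LHS]mulr1 -dd mulrA dA mul1r.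
  by rewrite mulrC.
pose n j := z * m 0 j.
have n1 j : n j * (n j)^* = 1 by rewrite rmorphM mulrACA z1 m1 mulr1.
have n0 j := mulJ1_neq0 (n1 j); have nV j := mulJ1_conj (n1 j).
have n123 : n 0 * n 1 * n 2 = 1 by rewrite -dA -z3 /d prod3E /n; ring.
(* The torus entries st, t/s, t^-2 have to be n_0, n_1, n_2. The third one dictates t up to sign,
   the first one gives s = n_0 / t, and the second one then holds because n_0 n_1 n_2 = 1. The
   opposite sign of t changes (s, t) into (-s, -t). *)
pose t := sqrtC (n 2)^-1; have t2 : t ^+ 2 = (n 2)^-1 by exact: sqrtCK.
have t1 : t * t^* = 1 by apply: expr_mulJ1 t2 _; rewrite // -nV conjCK mulrC.
have t0 := mulJ1_neq0 t1.
have [tu tuE] := U1_of t1.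
have [su suE] : exists u : U1 C, U1_val u = n 0 / t.
  apply: U1_of; rewrite rmorphM mulrACA n1 mul1r fmorphV -invfM.
  by rewrite t1 invr1.
exists (su, tu, A', B'); apply: E6gwP => X; rewrite phiE aE /act /block_action.
have -> : torus_mx (su, tu, A', B') = diag_mx (z *: m).
  congr diag_mx; apply/rowP => j; rewrite /= suE tuE mxE [RHS]mxE -/(n j).
  case: (ord3P j) => -> /=; first by rewrite mulfVK.
    apply: (mulfI (n0 0)); apply: (mulIf (n0 2)); rewrite n123.
    have -> : n 0 * ((n 0 / t)^-1 * t) = t ^+ 2 by field; rewrite n0 t0.
    by rewrite t2 mulVf.
  by rewrite t2 invrK.
rewrite A'E B'E !linearZ /= !map_mxZ /=.
congr mkJ.
- rewrite -!scalemxAl -scalemxAr scalerA -rmorphM ?mulVf ?mulfV //.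
  by rewrite rmorph1 scale1r.
- by rewrite -!scalemxAl scalerA divff // scale1r.
- by rewrite map_diag_mx -!scalemxAl -scalemxAr scalerA z1 scale1r.
Qed.

(** * The kernel of [phi] *)

Lemma act_scalar (x : G) (d : C) X : d * d^* = 1 ->
  x.1.2 = d^*%:M :> 'M_3 -> x.2 = d%:M :> 'M_3 -> torus_mx x = d%:M -> act x X = X.
Proof.
move=> d1 hA hB hD; rewrite /act hA hB hD !tr_scalar_mx !map_scalar_mx.
rewrite !mul_scalar_mx !mul_mx_scalar /= conjCK.
by rewrite !scalerA ?(mulrC d^*) !d1 !scale1r mkJK.
Qed.

Lemma phi1 : phi (1%g : G) = 1%g.
Proof. by apply: E6gwP => X; rewrite phiE act1 id_lfunE. Qed.

Lemma phiV (x : G) : phi x^-1%g = (phi x)^-1%g.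
Proof. by apply: (mulgI (phi x)); rewrite -phiM !mulgV phi1. Qed.

Lemma torus_mx_scalar (s t : U1 C) A B (d : C) :
  U1_val s * U1_val t = d -> (U1_val s)^-1 * U1_val t = d ->
  U1_val t ^- 2 = d -> torus_mx (s, t, A, B) = d%:M.
Proof.
move=> h0 h1 h2; rewrite -diag_const_mx; congr diag_mx; apply/rowP => j.
by case: (ord3P j) => ->; rewrite !mxE.
Qed.

Lemma phi_Z2 (x : G) : x \in @Z2 C -> phi x = 1%g.
Proof.
rewrite !inE => /orP[]/eqP->; first exact: phi1.
apply: E6gwP => X; rewrite phiE id_lfunE; apply: (@act_scalar _ 1).
- by rewrite mul1r conjC1.
- by rewrite conjC1.
- by [].
- apply: torus_mx_scalar => /=;
    by rewrite ?sqrrN ?expr1n ?invrN ?invr1 ?mulrNN ?mulr1.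
Qed.

Lemma omega_conj : omega * omega^* = 1.
Proof. by rewrite -normCK (eqP (omega_U1 C)) expr1n. Qed.

Lemma omega_neq0 : omega != 0.
Proof. exact: mulJ1_neq0 omega_conj. Qed.

Lemma omegaV : omega^-1 = omega ^+ 2.
Proof.
by apply: (mulfI omega_neq0); rewrite mulfV ?omega_neq0 // -exprS omega_expr3.
Qed.

Lemma phi_Z3 (x : G) : x \in @Z3 C -> phi x = 1%g.
Proof.
have hw : phi ((1, U1_omega C, (SU3_omega C)^-1, SU3_omega C)%g : G) = 1%g.
  apply: E6gwP => X; rewrite phiE id_lfunE; apply: (@act_scalar _ omega).
  - exact: omega_conj.
  - by rewrite /= invmx_scalar (mulJ1_conj omega_conj).
  - by [].
  - apply: torus_mx_scalar => /=; rewrite ?invr1 ?mul1r //.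
    by rewrite -omegaV invrK.
rewrite !inE => /or3P[]/eqP->; [exact: phi1|exact: hw|].
suff -> : (1, (U1_omega C)^-1, SU3_omega C, (SU3_omega C)^-1)%g
    = ((1, U1_omega C, (SU3_omega C)^-1, SU3_omega C)%g : G)^-1%g.
  by rewrite phiV hw invg1.
by congr (_, _, _, _); rewrite ?invg1 ?invgK.
Qed.

(** Let D be the torus matrix. The test values b = E and c = E give A = conj(D) and B = D; a general
    b then shows that D commutes with every matrix, so D is scalar. *)
Lemma act_id (x : G) : (forall X, act x X = X) -> exists d : C,
  [/\ torus_mx x = d%:M, x.1.2 = d^*%:M :> 'M_3, x.2 = d%:M :> 'M_3 &
      d * d^* = 1].
Proof.
move=> h.
have hb b : (x.1.2 : 'M_3) *m b *m torus_mx x = b.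
  by have := congr1 (@zb C) (h (mkJ 0 b 0)); rewrite !zb_mkJ.
have hc c : (x.2 : 'M_3) *m c *m (torus_mx x) ^ conjC = c.
  by have := congr1 (@zc C) (h (mkJ 0 0 c)); rewrite !zc_mkJ.
have hA : x.1.2 = (torus_mx x) ^ conjC :> 'M_3.
  have := hb 1%:M; rewrite mulmx1 => e.
  by rewrite -[LHS]mulmx1 -(torus_mx_conjr x) mulmxA e mul1mx.
have hB : x.2 = torus_mx x :> 'M_3.
  have := hc 1%:M; rewrite mulmx1 => e.
  by rewrite -[LHS]mulmx1 -(torus_mx_conj x) mulmxA e mul1mx.
have hD : torus_mx x = (torus_mx x 0 0)%:M.
  apply: commuting_scalar => M.
  by rewrite -[in LHS](hb M) hA !mulmxA torus_mx_conjr mul1mx.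
exists (torus_mx x 0 0); split=> //.
- by rewrite hA {1}hD map_scalar_mx.
- by rewrite hB {1}hD.
have := torus_mx_conjr x; rewrite hD map_scalar_mx -scalar_mxM.
move=> /matrixP/(_ 0 0).
by rewrite !mxE !eqxx !mulr1n.
Qed.

Lemma U1_inj : injective (@U1_val C). Proof. exact: val_inj. Qed.

Lemma mem_Z3 (x : G) (d : C) :
  d ^+ 3 = 1 -> x.1.1.1 = 1%g -> U1_val x.1.1.2 = d ->
  x.1.2 = d^-1%:M :> 'M_3 -> x.2 = d%:M :> 'M_3 -> x \in @Z3 C.
Proof.
case: x => [[[s t] A] B] /= /(prim_rootP (omega_prim C))[k dk] -> ht hA hB.
rewrite !inE; have : [\/ d = 1, d = omega | d = omega^-1].
  rewrite dk omegaV; case: (ord3P k) => ->;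
    by [constructor 1|constructor 2|constructor 3].
case=> dE; rewrite {dk}dE in ht hA hB.
- have -> : t = 1%g by apply: U1_inj; rewrite ht.
  have -> : A = 1%g by apply: val_inj; rewrite /= hA invr1.
  have -> : B = 1%g by apply: val_inj; rewrite /= hB.
  by rewrite eqxx.
- have -> : t = U1_omega C by apply: U1_inj; rewrite ht.
  have -> : A = (SU3_omega C)^-1%g by apply: val_inj; rewrite /= hA invmx_scalar.
  have -> : B = SU3_omega C by apply: val_inj; rewrite /= hB.
  by rewrite eqxx orbT.
- have -> : t = (U1_omega C)^-1%g by apply: U1_inj; rewrite ht.
  have -> : A = SU3_omega C by apply: val_inj; rewrite /= hA invrK.
  have -> : B = (SU3_omega C)^-1%g by apply: val_inj; rewrite /= hB invmx_scalar.
  by rewrite eqxx !orbT.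
Qed.

Lemma ker_phi (x : G) : reflect (phi x = 1%g) (x \in @in_Z2Z3 C).
Proof.
apply: (iffP idP) => [/in_Z2Z3P[[a b] /= [aZ bZ ->]]|h].
  by rewrite phiM phi_Z2 // phi_Z3 // mulg1.
have [|d [hD hA hB d1]] := @act_id x.
  by move=> X; rewrite -phiE h id_lfunE.
move: hD hA hB {h}; case: x => [[[s t] A] B] /= hD hA hB.
have hd j : torus (U1_val s) (U1_val t) 0 j = d.
  by have /matrixP/(_ j j) := hD; rewrite [LHS]mxE [RHS]mxE eqxx !mulr1n.
have := hd 0; have := hd 1; rewrite !mxE /= => e1 e0.
have d3 : d ^+ 3 = 1 by have := SU3_det B; rewrite hB det_scalar.
(* The first two torus entries st and t/s both equal d. *)
have s2 : U1_val s ^+ 2 = 1.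
  have t0 := U1_unit t; have s0 := U1_unit s.
  apply: (mulIf t0); rewrite mul1r expr2 -mulrA e0 -e1.
  by rewrite mulrA mulfV ?mul1r.
have ss : (s * s)%g = 1%g by apply: U1_inj.
(* Since s = 1 or s = -1, the first factor lies in Z_2 and the product is (s, t, A, B). The second
   factor lies in Z_3 because st = d is a cube root of unity, by det B = 1. *)
apply/in_Z2Z3P; exists ((s, s, 1, 1)%g, (1, s * t, A, B)%g); split.
- rewrite /= !inE; move/eqP: s2; rewrite sqrf_eq1 => /orP[]/eqP sE.
    by have -> : s = 1%g; [apply: U1_inj; rewrite sE|rewrite eqxx].
  have -> : s = U1_N1 C by apply: U1_inj; rewrite sE.
  by rewrite eqxx orbT.
- by apply: (@mem_Z3 _ d) => //=; rewrite -(mulJ1_conj d1).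
- by congr (_, _, _, _); rewrite /= ?mulg1 ?mul1g // mulgA ss mul1g.
Qed.
End Surj.

(** * Topology *)

Import numFieldNormedType.Exports.
Local Open Scope classical_set_scope.

Lemma continuous_into_initial (S : choiceType) (T X : topologicalType)
  (f : S -> T) (g : X -> initial_topology f) :
  continuous (f \o g : X -> T) -> continuous g.
Proof.
move=> /continuousP cfg; apply/continuousP => _ [O oO <-].
by rewrite -comp_preimage; exact: cfg.
Qed.

Lemma continuous_pairing (X S T : topologicalType) (f : X -> S) (g : X -> T) :
  continuous f -> continuous g -> continuous (fun x => (f x, g x)).
Proof. by move=> cf cg x; exact: cvg_pair (cf x) (cg x). Qed.

Lemma continuous_compose (X S T : topologicalType) (f : X -> S) (g : S -> T) :
  continuous f -> continuous g -> continuous (fun x => g (f x)).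
Proof. by move=> cf cg x; apply: continuous_comp; [exact: cf|exact: cg]. Qed.

Lemma continuous_fst (X S T : topologicalType) (f : X -> S * T) :
  continuous f -> continuous (fun x => (f x).1).
Proof. by move=> cf x; apply: (continuous_comp (cf x)); exact: cvg_fst. Qed.

Lemma continuous_snd (X S T : topologicalType) (f : X -> S * T) :
  continuous f -> continuous (fun x => (f x).2).
Proof. by move=> cf x; apply: (continuous_comp (cf x)); exact: cvg_snd. Qed.

Lemma continuous_into_ptws (X T : topologicalType) (S : Type)
  (g : X -> S -> T) :
  (forall s, continuous (g^~ s)) -> continuous (g : X -> {ptws S -> T}).
Proof.
move=> cg x; apply/cvg_sup => s.
exact: (@continuous_into_initial _ _ _ (fun f : S -> T => f s) g (cg s) x).
Qed.

Lemma cluster_continuous (S T : topologicalType) (f : S -> T) p q :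
  continuous f -> cluster (nbhs p) q -> cluster (nbhs (f p)) (f q).
Proof.
by move=> cf pq A B /cf nA /cf nB; have [z [? ?]] := pq _ _ nA nB; exists (f z).
Qed.

(** If q is a cluster point of the neighbourhoods of p, then f q is one for f p; separation in T
    gives f p = f q. *)
Lemma initial_hausdorff (S : choiceType) (T : topologicalType) (f : S -> T) :
  injective f -> hausdorff_space T -> hausdorff_space (initial_topology f).
Proof.
move=> f_inj hT p q pq; apply/f_inj/hT.
exact: cluster_continuous (@initial_continuous _ _ f) pq.
Qed.

(** Open sets of the initial topology are preimages of open sets, so a filter clusters at s as soon
    as its image clusters at f s. *)
Lemma initial_compact (S : choiceType) (T : topologicalType) (f : S -> T) :
  compact (range f) -> compact [set: initial_topology f].
Proof.
move=> cf F FF _; have fF : (f @ F) (range f).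
  by apply: (@filterS _ F _ setT) => [x _|]; [exists x|exact: filterT].
have [_ [[s _ <-] cl_s]] := cf _ _ fF.
exists s; split=> // A B FA [_ [[O oO <-] Os] OB].
have [_ [[z Az <-] Oz]] : f @` A `&` O !=set0.
  apply: cl_s; last exact: open_nbhs_nbhs.
  by apply: (@filterS _ F _ A) => // x Ax; exists x.
by exists z; split=> //; exact: OB.
Qed.

Lemma prod_hausdorff (S T : topologicalType) :
  hausdorff_space S -> hausdorff_space T -> hausdorff_space (S * T)%type.
Proof.
move=> hS hT [p1 p2] [q1 q2] pq; congr (_, _).
  by apply: hS; apply: (@cluster_continuous _ _ fst) pq => z; exact: cvg_fst.
by apply: hT; apply: (@cluster_continuous _ _ snd) pq => z; exact: cvg_snd.
Qed.

Lemma fmap_ultra (S T : Type) (f : S -> T) (F : set_system S) :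
  UltraFilter F -> UltraFilter (f @ F).
Proof.
move=> FU; split=> [|G GF FG]; first exact: fmap_proper_filter.
apply/seteqP; split=> // A GA.
have [//|FA] := in_ultra_setVsetC (f @^-1` A) FU.
by have [x [Ax]] := filter_ex (filterI GA (FG (~` A) FA)).
Qed.

(** Along an ultrafilter every entry converges in A; the index sets being finite, the entrywise
    limits form a limit of the matrices. *)
Lemma matrix_compact (T : topologicalType) m n (A : set T) : compact A ->
  compact [set M : 'M[T]_(m, n) | forall i j, A (M i j)].
Proof.
rewrite !compact_ultra => cA F FF FA.
pose entry i j (M : 'M[T]_(m, n)) := M i j.
have lim i j : exists p, A p /\ entry i j @ F --> p.
  have [||p [Ap Fp]] := cA (entry i j @ F); last by exists p.
    exact: fmap_ultra.
  by apply: (@filterS _ F _ _ _ _ FA) => M; apply.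
have [p Ap] := fin_all_exists (fun i => fin_all_exists (lim i)).
exists (\matrix_(i, j) p i j); split=> [i j|]; first by rewrite mxE; case: (Ap i j).
move=> B [P nP PB]; apply: (filterS PB).
apply: filter_forall => i; apply: filter_forall => j.
by have [_] := Ap i j; apply; have := nP i j; rewrite mxE.
Qed.

(** * Continuity of scalar and matrix operations *)

Section Continuity.
Variables (C : numClosedFieldType) (X : topologicalType).
Implicit Types f g : X -> C.

Lemma conjC_continuous : continuous (conjC : C -> C).
Proof.
move=> z /= A /(nbhs_ballP (z^*)) [e e0 eA].
apply/nbhs_ballP; exists e => // w zw.
by apply: eA; move: zw; rewrite -!ball_normE /= -rmorphB norm_conjC.
Qed.

Lemma continuous_conj f : continuous f -> continuous (fun x => (f x)^*).
Proof.
by move=> cf x; apply: (continuous_comp (cf x)); exact: conjC_continuous.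
Qed.

Lemma continuous_add f g :
  continuous f -> continuous g -> continuous (fun x => f x + g x).
Proof. by move=> cf cg x; exact: cvgD (cf x) (cg x). Qed.

Lemma continuous_opp f : continuous f -> continuous (fun x => - f x).
Proof. by move=> cf x; exact: cvgN (cf x). Qed.

Lemma continuous_mul f g :
  continuous f -> continuous g -> continuous (fun x => f x * g x).
Proof. by move=> cf cg x; exact: cvgM (cf x) (cg x). Qed.

Lemma continuous_cst (c : C) : continuous (fun _ : X => c).
Proof. by move=> x; exact: cvg_cst. Qed.

Lemma continuous_sum (I : Type) (r : seq I) (F : I -> X -> C) :
  (forall i, continuous (F i)) -> continuous (fun x => \sum_(i <- r) F i x).
Proof.
move=> cF; elim: r => [|i r IHr].
  by under [X in continuous X]eq_fun do rewrite big_nil; exact: continuous_cst.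
by under [X in continuous X]eq_fun do rewrite big_cons; exact: continuous_add.
Qed.

Definition mx_entrywise_continuous m n (F : X -> 'M[C]_(m, n)) :=
  forall i j, continuous (fun x => F x i j).

Lemma continuous_mulmx m n p (F : X -> 'M[C]_(m, n)) (G : X -> 'M[C]_(n, p)) :
  mx_entrywise_continuous F -> mx_entrywise_continuous G ->
  mx_entrywise_continuous (fun x => F x *m G x).
Proof.
move=> cF cG i j; under [X in continuous X]eq_fun do rewrite mxE.
by apply: continuous_sum => k; exact: continuous_mul.
Qed.

Lemma continuous_conjmx m n (F : X -> 'M[C]_(m, n)) :
  mx_entrywise_continuous F -> mx_entrywise_continuous (fun x => (F x) ^ conjC).
Proof.
move=> cF i j; under [X in continuous X]eq_fun do rewrite mxE.
exact: continuous_conj.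
Qed.

Lemma continuous_tcmx m n (F : X -> 'M[C]_(m, n)) :
  mx_entrywise_continuous F -> mx_entrywise_continuous (fun x => (F x)^t*).
Proof.
move=> cF i j; under [X in continuous X]eq_fun do rewrite 2!mxE.
exact: continuous_conj.
Qed.

Lemma continuous_cstmx m n (M : 'M[C]_(m, n)) :
  mx_entrywise_continuous (fun _ => M).
Proof. by move=> i j; exact: continuous_cst. Qed.

Lemma closed_eq_continuous f g :
  continuous f -> continuous g -> closed [set x | f x = g x].
Proof.
move=> cf cg.
have -> : [set x | f x = g x] = (fun x => f x - g x) @^-1` [set 0].
  by apply/seteqP; split=> x /= => [->|/eqP]; rewrite ?subrr // subr_eq0 => /eqP.
apply: preimage_closed => [x _|].
  exact: continuous_add cf (continuous_opp cg) x.
apply: compact_closed; last exact: compact_set1.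
exact: (@norm_hausdorff C C^o).
Qed.
End Continuity.

(** * Continuity of [phi] and separation of its target *)

Section PhiContinuous.
Variables (C : numClosedFieldType).
Local Notation G := (U1 C * U1 C * SU3 C * SU3 C)%type.

Lemma continuous_quat (X : topologicalType) (a b c d : X -> C) :
  continuous a -> continuous b -> continuous c -> continuous d ->
  continuous (fun x => Quat (a x) (b x) (c x) (d x) : quat C).
Proof.
move=> ca cb cc cd; apply: (@continuous_into_initial _ _ _ (@quat_tuple C)).
exact: continuous_pairing (continuous_pairing (continuous_pairing ca cb) cc) cd.
Qed.

Lemma continuous_jordan (X : topologicalType) (a b c : X -> C)
  (x1 x2 x3 : X -> oct C) :
  continuous a -> continuous b -> continuous c ->
  continuous x1 -> continuous x2 -> continuous x3 ->
  continuous (fun x => Jordan (a x) (b x) (c x) (x1 x) (x2 x) (x3 x) : jordan C).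
Proof.
move=> ca cb cc c1 c2 c3.
apply: (@continuous_into_initial _ _ _ (@jordan_tuple C)).
exact: continuous_pairing (continuous_pairing (continuous_pairing
  (continuous_pairing (continuous_pairing ca cb) cc) c1) c2) c3.
Qed.

Lemma continuous_mkJ (X : topologicalType) (M b c : X -> 'M[C]_3) :
  mx_entrywise_continuous M -> mx_entrywise_continuous b ->
  mx_entrywise_continuous c ->
  continuous (fun x => mkJ (M x) (b x) (c x)).
Proof.
move=> cM cb cc.
have cre (p m : X -> C) : continuous p -> continuous m ->
    continuous (fun x => (p x + m x) / 2).
  move=> cp cm.
  exact: continuous_mul (continuous_add cp cm) (@continuous_cst _ _ _).
have cim (p m : X -> C) : continuous p -> continuous m ->
    continuous (fun x => 'i * (m x - p x) / 2).
  move=> cp cm; apply: (continuous_mul _ (@continuous_cst _ _ _)).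
  exact: continuous_mul (@continuous_cst _ _ _)
    (continuous_add cm (continuous_opp cp)).
by apply: continuous_jordan; [exact: cM|exact: cM|exact: cM|..];
  apply: continuous_pairing;
  (apply: continuous_quat; [exact: cre|exact: cim|exact: cre|exact: cim]).
Qed.

Lemma U1_val_continuous : continuous (@U1_val C : U1 C -> C).
Proof. exact: (@initial_continuous _ _ (@U1_val C)). Qed.

Lemma SU3_val_continuous :
  mx_entrywise_continuous (fun A : SU3 C => A : 'M[C]_3).
Proof.
move=> i j A; apply: (@continuous_comp _ _ _ _ (fun M : 'M[C]_3 => M i j)).
  exact: (@initial_continuous _ _ (@SU3_val C)).
exact: coord_continuous.
Qed.

Lemma phi_continuous : continuous (@phi C : G -> E6_gamma3_w3 C).
Proof.
(* Three nested initial topologies are peeled off, down to pointwise convergence; it remains to vary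
   x in [act x X] with X fixed. *)
apply: (@continuous_into_initial _ _ _ (@E6gw_val C)).
apply: (@continuous_into_initial _ _ _ (@E6_val C)).
apply: (@continuous_into_initial _ _ _ (fun a : liso (jordan C) =>
       (fun X => a X) : {ptws jordan C -> jordan C})).
apply: continuous_into_ptws => X.
rewrite (_ : _^~ _ = (fun x : G => act x X)); last first.
  by apply/funext => x; rewrite -phiE.
have c0 : continuous (fun x : G => x) by move=> x; exact: cvg_id.
have c123 := continuous_fst c0; have c12 := continuous_fst c123.
have c1 : continuous (fun x : G => U1_val x.1.1.1).
  exact: continuous_compose (continuous_fst c12) U1_val_continuous.
have c2 : continuous (fun x : G => U1_val x.1.1.2).
  exact: continuous_compose (continuous_snd c12) U1_val_continuous.
have c3 : mx_entrywise_continuous (fun x : G => x.1.2 : 'M[C]_3).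
  move=> i j.
  exact: continuous_compose (continuous_snd c123) (@SU3_val_continuous i j).
have c4 : mx_entrywise_continuous (fun x : G => x.2 : 'M[C]_3).
  move=> i j.
  exact: continuous_compose (continuous_snd c0) (@SU3_val_continuous i j).
have cD : mx_entrywise_continuous (fun x : G => torus_mx x).
  (* On U(1) inverses are conjugates, so continuity of conjugation and of products suffices. *)
  pose d (x : G) := nth 0 [:: U1_val x.1.1.1 * U1_val x.1.1.2;
    (U1_val x.1.1.1)^* * U1_val x.1.1.2; (U1_val x.1.1.2)^* * (U1_val x.1.1.2)^*].
  move=> i j; rewrite (_ : (fun _ => _) = fun x : G => (i == j)%:R * d x i).
    apply: continuous_mul; first exact: continuous_cst.
    rewrite /d; case: (ord3P i) => -> /=; apply: continuous_mul => //;
      exact: continuous_conj.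
  apply/funext => x; rewrite [LHS]mxE -[LHS]mulr_natl; congr (_ * _).
  by rewrite /d; case: (ord3P i) => ->; rewrite mxE /= ?U1_conj // -expr2 exprVn.
apply: continuous_mkJ; (apply: continuous_mulmx; first apply: continuous_mulmx).
- exact: continuous_conjmx.
- exact: continuous_cstmx.
- exact: continuous_tcmx.
- exact: c3.
- exact: continuous_cstmx.
- exact: cD.
- exact: c4.
- exact: continuous_cstmx.
- exact: continuous_conjmx.
Qed.

(** The group injects into the functions from J^C to itself and carries the induced pointwise
    topology; that space is Hausdorff because J^C is in coordinates a product of copies of C. *)
Lemma E6gw_hausdorff : hausdorff_space (E6_gamma3_w3 C).
Proof.
have hC : hausdorff_space C by exact: (@norm_hausdorff C C^o).
have hquat : hausdorff_space (quat C).
  apply: (@initial_hausdorff _ _ (@quat_tuple C)).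
    exact: can_inj (@quat_tupleK C).
  by do 3!(apply: prod_hausdorff => //).
have hoct : hausdorff_space (oct C) by exact: prod_hausdorff.
have hjordan : hausdorff_space (jordan C).
  apply: (@initial_hausdorff _ _ (@jordan_tuple C)).
    exact: can_inj (@jordan_tupleK C).
  by do 5!(apply: prod_hausdorff => //).
apply: (@initial_hausdorff _ _ (@E6gw_val C)); first exact: val_inj.
apply: (@initial_hausdorff _ _ (@E6_val C)); first exact: val_inj.
apply: (@initial_hausdorff _ _ (fun a : liso (jordan C) =>
       (fun X => a X) : {ptws jordan C -> jordan C})).
  move=> a b ab; apply: val_inj; apply/lfunP => X.
  exact: (@congr1 (jordan C -> jordan C) _ (fun h => h X) _ _ ab).
exact: hausdorff_product.
Qed.
End PhiContinuous.

(** * Compactness of U(1) and SU(3) *)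

Section Compactness.
Variable R : realType.
Local Notation C := (cplx R).

(** The compact set is the image of the square with sides [-1, 1]; containing the disc is enough, as
    closed subsets are cut out of it later. *)
Lemma disc_in_compact :
  exists2 K : set C, compact K & forall z : C, `|z| <= 1 -> K z.
Proof.
pose h (xy : R * R) : C := (xy.1 +i* xy.2)%C.
have ch : continuous h.
  move=> [x y] A /(nbhs_ballP (h (x, y))) [e e0 eA].
  (* Radii of balls in C are themselves elements of C; positivity forces their imaginary part to
     vanish. *)
  have [e1 eE] : exists e1 : R, e = e1%:C%C :> R[i].
    exists (complex.Re e); have e0' : (0 : R[i]) < e := e0.
    rewrite [LHS]complexE; move: e0'; rewrite ltcE => /andP[/eqP/= -> _].
    by rewrite mulr0 addr0.
  have e10 : 0 < e1 / 2 by rewrite divr_gt0 // -ltcR -eE; exact: e0.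
  apply/(nbhs_ballP (x, y)); exists (e1 / 2) => // -[x' y'] [/= bx by_].
  apply: eA.
  rewrite eE -ball_normE /=; move: bx by_; rewrite -!ball_normE /= => bx by_.
  change (`|((x - x') +i* (y - y'))%C : R[i]| < e1%:C%C).
  rewrite normc_def ltcR /=.
  have e1p : 0 < e1 by lra.
  rewrite -(@ltr_pXn2r _ 2) ?nnegrE ?sqrtr_ge0 ?(ltW e1p) //.
  rewrite sqr_sqrtr ?addr_ge0 ?sqr_ge0 //.
  rewrite -(real_normK (num_real (x - x'))) -(real_normK (num_real (y - y'))).
  have := normr_ge0 (x - x'); have := normr_ge0 (y - y'); nra.
exists (h @` (`[-1, 1] `*` `[-1, 1])).
  apply: continuous_compact; first exact: continuous_subspaceT.
  by apply: compact_setX; exact: segment_compact.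
move=> [a b] ab1; have : `|(a +i* b)%C : R[i]| <= 1%:C%C := ab1.
rewrite normc_def lecR /= => {}ab1; exists (a, b) => //=.
have : a ^+ 2 + b ^+ 2 <= 1.
  rewrite -(sqr_sqrtr (addr_ge0 (sqr_ge0 a) (sqr_ge0 b))).
  by rewrite expr_le1 ?sqrtr_ge0.
rewrite !in_itv /= => ab; split; apply/andP; split; nra.
Qed.

Lemma U1_compact : compact [set: U1 C].
Proof.
apply: (@initial_compact _ _ (@U1_val C)); have [K cK disc] := disc_in_compact.
apply: (subclosed_compact _ cK) => [|_ [u _ <-]]; last first.
  by apply: disc; rewrite U1_norm.
have -> : range (@U1_val C) = [set z | z * z^* = 1].
  apply/seteqP; split=> [_ [u _ <-]|z /= /U1_of[u <-]]; last by exists u.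
  by rewrite /= -normCK U1_norm expr1n.
have cid : continuous (fun z : C => z) by move=> z; exact: cvg_id.
apply: closed_eq_continuous; last exact: continuous_cst.
exact: continuous_mul cid (continuous_conj cid).
Qed.

Lemma SU3_compact : compact [set: SU3 C].
Proof.
apply: (@initial_compact _ _ (@SU3_val C)); have [K cK disc] := disc_in_compact.
have cid : mx_entrywise_continuous (fun A : 'M[C]_3 => A).
  by move=> i j; exact: coord_continuous.
apply: (subclosed_compact _ (@matrix_compact _ 3 3 _ cK)) => [|_ [U _ <-] i j];
  last first.
  (* The rows of a unitary matrix have norm 1, which bounds each entry by 1. *)
  apply: disc; rewrite -(@expr_le1 _ 2) // normCK.
  have /unitarymxP/matrixP/(_ i i) := SU3_unitary U.
  rewrite [LHS]mxE [RHS]mxE eqxx mulr1n => <-.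
  rewrite (bigD1 j) //= !mxE lerDl sumr_ge0 // => k _.
  by rewrite !mxE -normCK exprn_ge0.
(* The image is cut out by scalar equations between continuous functions of the matrix: det A = 1
   and the nine entries of A A^* = E. *)
have -> : range (@SU3_val C) = [set A | \det A = 1] `&`
   \bigcap_(ij in [set: 'I_3 * 'I_3])
     [set A | (A *m A^t*) ij.1 ij.2 = (1%:M : 'M[C]_3) ij.1 ij.2].
  apply/seteqP; split=> [_ [U _ <-]|A [/= dA uA]].
    split; first exact: SU3_det.
    by move=> ij _ /=; have /unitarymxP -> := SU3_unitary U.
  have [|U <-] := SU3_of _ dA; last by exists U.
  by apply/unitarymxP/matrixP => i j; exact: (uA (i, j)).
apply: closedI.
  apply: closed_eq_continuous; last exact: continuous_cst.
  have minor (a b c : 'I_3) : continuous (fun A : 'M[C]_3 =>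
      A 0 a * (A 1 b * A 2 c - A 1 c * A 2 b)).
    have co k l := @coord_continuous C 3 3 k l.
    exact: continuous_mul (co _ _) (continuous_add
      (continuous_mul (co _ _) (co _ _))
      (continuous_opp (continuous_mul (co _ _) (co _ _)))).
  have -> : @determinant C 3 = _ := funext (@det_mx33 C).
  exact: continuous_add (continuous_add (minor 0 1 2)
    (continuous_opp (minor 1 0 2))) (minor 2 0 1).
have cU : mx_entrywise_continuous (fun A : 'M[C]_3 => A *m A^t*).
  exact: (@continuous_mulmx _ _ 3 3 3 _ _ cid (@continuous_tcmx _ _ 3 3 _ cid)).
apply: closed_bigI => -[i j] _.
exact: closed_eq_continuous (cU i j) (@continuous_cst _ _ _).
Qed.
End Compactness.

(** * Descent of [phi] to the quotient by its kernel, and continuity of the inverse *)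

Theorem theorem4p8p3 (R : realType) :
  let G := quotient_group (Z2Z3 (cplx R)) in
  let H := E6_gamma3_w3 (cplx R) in
  exists (f : {multiplicative G -> H}) (g : H -> G),
    [/\ cancel f g, cancel g f,
        continuous (f : quotient_topology G -> H) &
        continuous (g : H -> quotient_topology G)].
Proof.
move=> G H.
pose pi : _ -> G := \pi_G%qT.
pose f (q : G) : H := phi (repr q).
(* The value does not depend on the representative because elements of Z_2 x Z_3 act trivially. *)
have f_pi x : f (pi x) = phi x.
  have : coset_rel (Z2Z3 (cplx R)) x (repr (pi x)).
    by apply/eqmodP; rewrite reprK.
  rewrite /coset_rel => /ker_phi; rewrite phiM phiV => h.
  by apply: (mulgI (phi x)^-1%g); rewrite h mulVg.
have fM : {morph f : x y / (x * y)%g}.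
  move=> p q; have <- : pi (repr p) = p by exact: reprK.
  have <- : pi (repr q) = q by exact: reprK.
  have <- : pi (repr p * repr q)%g = (pi (repr p) * pi (repr q))%g.
    exact: quot_piM.
  by rewrite !f_pi phiM.
have f_inj : injective f.
  move=> p q; have <- : pi (repr p) = p by exact: reprK.
  have <- : pi (repr q) = q by exact: reprK.
  rewrite !f_pi => e; apply/eqmodP/ker_phi.
  by rewrite phiM phiV e mulVg.
have f_surj a : exists q, f q = a.
  by have [x <-] := phi_surj a; exists (pi x).
have [g gK] := choice f_surj.
have fK : cancel f g by move=> q; apply: f_inj; rewrite gK.
have f_cont : continuous (f : quotient_topology G -> H).
  apply/quotient_continuous.
  have -> : f \o \pi_(quotient_topology G)%qT = @phi (cplx R).
    by apply/funext => x; exact: f_pi.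
  exact: phi_continuous.
pose F : {multiplicative G -> H} :=
  HB.pack f (isMultiplicative.Build G H f fM).
exists F, g; split=> //.
have Q_compact : compact [set: quotient_topology G].
  have -> : [set: quotient_topology G] = pi @` setT.
    by apply/seteqP; split=> // q _; exists (repr q) => //; exact: reprK.
  apply: continuous_compact; first by apply: continuous_subspaceT; exact: pi_continuous.
  rewrite -!setXTT.
  do 3!(apply: compact_setX; last by [exact: SU3_compact|exact: U1_compact]).
  exact: U1_compact.
apply/continuous_closedP => A cA.
(* This turns continuity of g into closedness of f: a closed A is compact in the quotient, so its
   image is compact in a Hausdorff space. *)
have -> : g @^-1` A = f @` A.
  by apply/seteqP; split=> [a /= Ag|_ [q Aq <-] /=]; [exists (g a)|rewrite fK].
apply: compact_closed; first exact: E6gw_hausdorff.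
apply: continuous_compact; first exact: continuous_subspaceT.
exact: subclosed_compact cA Q_compact _.
Qed.
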